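(* Endow $A_{\mathrm{univ}}=\mathbb{Z}[h,t][X]/(X^2-hX-t)$ with the structure of a $\mathbb{Z}[G]$-module by letting $G$ act as multiplication by $2X-h$. Then for every knot $K\subset S^3$ there is a homotopy equivalence (of complexes of $A_{\mathrm{univ}}$-modules) $$C_{\mathrm{univ}}(K)\simeq\llbracket K\rrbracket\otimes_{\mathbb{Z}[G]}A_{\mathrm{univ}}\{1\}.$$
   Context: For a graded module $M$, $M\{m\}_n=M_{n-m}$ (shift in quantum degree). **Complex of a Frobenius system.** Let $(R,A,\Delta,\epsilon)$ be a rank 2 Frobenius system: $R$ a graded commutative ring, $A$ a commutative $R$-algebra, free as an $R$-module on $1$ (degree $0$) and $X$ (degree $-2$), with comultiplication $\Delta$ and counit $\epsilon$. Let $D$ be a diagram of an oriented knot $K$ with a base point away from crossings, with $n_+$ positive and $n_-$ negative crossings. Every crossing has a 0- and a 1-resolution; the orientation-compatible one is the 0-resolution for positive and the 1-resolution for negative crossings. To a complete resolution with $k+1$ circles associate $A\{1\}^{\otimes(k+1)}$ (tensor over $R$), an $A$-module via the factor of the circle containing the base point. To an edge of the cube of resolutions (one 0-resolution is changed to a 1-resolution) associate, with the usual signs making all squares anticommute, the multiplication $m$ on the factors of two merging circles or $\Delta$ on the factor of a splitting circle. A resolution with $r$ 1-resolutions is placed in homological degree $r-n_-$ and shifted additionally by $\{r+n_+-2n_-\}$. This gives a complex of free graded $A$-modules, whose homotopy type depends only on $K$. **$C_{\mathrm{univ}}(K)$** is this complex for $R_{\mathrm{univ}}=\mathbb{Z}[h,t]$,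 $A_{\mathrm{univ}}=\mathbb{Z}[h,t][X]/(X^2-hX-t)$, $\Delta(1)=1\otimes X+X\otimes1-h\,1\otimes1$, $\Delta(X)=X\otimes X+t\,1\otimes1$, $\epsilon(1)=0$, $\epsilon(X)=1$, $\deg X=\deg h=-2$, $\deg t=-4$. **$\llbracket K\rrbracket$**: let $C_{\mathbb{Z}[G]}(K)$ be this complex for $R=\mathbb{Z}[G]$ (polynomial ring), $A_{\mathbb{Z}[G]}=\mathbb{Z}[G][X]/(X^2+GX)$, $\Delta(1)=1\otimes X+X\otimes1+G\,1\otimes1$, $\Delta(X)=X\otimes X$, $\epsilon(1)=0$, $\epsilon(X)=1$, $\deg X=\deg G=-2$. Then $\llbracket K\rrbracket:=C_{\mathbb{Z}[G]}(K)\otimes_{A_{\mathbb{Z}[G]}}A_{\mathbb{Z}[G]}/(X)\{-1\}$, a complex of free graded $\mathbb{Z}[G]$-modules, well-defined up to homotopy equivalence. *)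

(* Defs.v *)
From HB Require Import structures.
From mathcomp Require Import all_boot all_order all_algebra.
From mathcomp Require Import boolp ring.

Set Implicit Arguments.
Unset Strict Implicit.
Unset Printing Implicit Defensive.

Import GRing.Theory.
Local Open Scope ring_scope.
Local Open Scope quotient_scope.

Section ExtensionOfScalars.
Variables (R S : comNzRingType) (phi : {rmorphism R -> S}) (M : lmodType R).

Inductive tens_eq : seq (M * S) -> seq (M * S) -> Prop :=
| tens_refl w : tens_eq w w
| tens_sym w1 w2 : tens_eq w1 w2 -> tens_eq w2 w1
| tens_trans w1 w2 w3 : tens_eq w1 w2 -> tens_eq w2 w3 -> tens_eq w1 w3
| tens_cat w1 w2 w1' w2' :
    tens_eq w1 w1' -> tens_eq w2 w2' -> tens_eq (w1 ++ w2) (w1' ++ w2')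
| tens_comm w1 w2 : tens_eq (w1 ++ w2) (w2 ++ w1)
| tens_zero m : tens_eq [:: (m, 0)] [::]
| tens_addl m m' s : tens_eq [:: (m + m', s)] [:: (m, s); (m', s)]
| tens_addr m s s' : tens_eq [:: (m, s + s')] [:: (m, s); (m, s')]
| tens_bal r m s : tens_eq [:: (r *: m, s)] [:: (m, phi r * s)].

Definition tens_eqb (w1 w2 : seq (M * S)) : bool := `[< tens_eq w1 w2 >].

Lemma tens_eqb_equiv : equiv_class_of tens_eqb.
Proof.
split=> [w|w1 w2|w2 w1 w3].
- exact/asboolP/tens_refl.
- by apply/asboolP/asboolP => /tens_sym.
- move=> /asboolP h12 /asboolP h23; apply/asboolP; exact: tens_trans h12 h23.
Qed.

Canonical tens_equiv := EquivRelPack tens_eqb_equiv.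
Canonical tens_encModRel := defaultEncModRel tens_eqb.

(* M (x)_R S, S being an R-module through phi; a word w stands for the
   formal sum of the m (x) s, (m, s) in w. *)
Definition ext := {eq_quot tens_eqb}.
HB.instance Definition _ := EqQuotient.on ext.
HB.instance Definition _ := Choice.on ext.

Definition ext_pi (w : seq (M * S)) : ext := \pi_ext w.

Lemma ext_piP w1 w2 : reflect (tens_eq w1 w2) (ext_pi w1 == ext_pi w2).
Proof. by rewrite /ext_pi piE; apply: asboolP. Qed.

Lemma ext_pi_eq w1 w2 : tens_eq w1 w2 -> ext_pi w1 = ext_pi w2.
Proof. by move=> h; apply/eqP/ext_piP. Qed.

Lemma ext_ind (P : ext -> Prop) : (forall w, P (ext_pi w)) -> forall x, P x.
Proof. by move=> h x; rewrite -[x]reprK; apply: h. Qed.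

Lemma ext_reprP w : tens_eq (repr (ext_pi w)) w.
Proof. by apply/ext_piP; rewrite /ext_pi reprK. Qed.

Definition ext_add (x y : ext) : ext := ext_pi (repr x ++ repr y).
Definition wscale (s : S) (w : seq (M * S)) := [seq (p.1, s * p.2) | p <- w].
Definition ext_scale (s : S) (x : ext) : ext := ext_pi (wscale s (repr x)).
Definition ext_opp (x : ext) : ext := ext_scale (-1) x.

Lemma tens_wscale s w1 w2 :
  tens_eq w1 w2 -> tens_eq (wscale s w1) (wscale s w2).
Proof.
elim=> {w1 w2} [w|w1 w2 _|w1 w2 w3 _ h1 _ h2|w1 w2 w1' w2' _ h1 _ h2|w1 w2|m
  |m m' t|m t t'|r m t].
- exact: tens_refl.
- exact: tens_sym.
- exact: tens_trans h1 h2.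
- by rewrite /wscale !map_cat; apply: tens_cat.
- by rewrite /wscale !map_cat; apply: tens_comm.
- by rewrite /= mulr0; apply: tens_zero.
- exact: tens_addl.
- by rewrite /= mulrDr; apply: tens_addr.
- by rewrite /= mulrCA; apply: tens_bal.
Qed.

Lemma ext_addE w1 w2 : ext_add (ext_pi w1) (ext_pi w2) = ext_pi (w1 ++ w2).
Proof. by apply/ext_pi_eq/tens_cat; apply: ext_reprP. Qed.

Lemma ext_scaleE s w : ext_scale s (ext_pi w) = ext_pi (wscale s w).
Proof. by apply/ext_pi_eq/tens_wscale; apply: ext_reprP. Qed.

Lemma ext_addA : associative ext_add.
Proof.
by elim/ext_ind=> x; elim/ext_ind=> y; elim/ext_ind=> z; rewrite !ext_addE catA.
Qed.

Lemma ext_addC : commutative ext_add.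
Proof.
elim/ext_ind=> x; elim/ext_ind=> y; rewrite !ext_addE.
exact/ext_pi_eq/tens_comm.
Qed.

Lemma ext_add0 : left_id (ext_pi [::]) ext_add.
Proof. by elim/ext_ind=> x; rewrite ext_addE. Qed.

Lemma ext_consE p w : ext_pi (p :: w) = ext_add (ext_pi [:: p]) (ext_pi w).
Proof. by rewrite ext_addE. Qed.

Lemma ext_scaleDl x : {morph ext_scale^~ x : s s' / s + s' >-> ext_add s s'}.
Proof.
elim/ext_ind: x => w s s' /=; rewrite !ext_scaleE.
elim: w => [|[m t] w IH] /=; first by rewrite ext_addE.
rewrite ext_consE IH (ext_consE (m, s * t)) (ext_consE (m, s' * t)) mulrDl.
rewrite (ext_pi_eq (tens_addr _ _ _)) (ext_consE (m, s * t) [:: _]).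
by rewrite -!ext_addA; congr ext_add; rewrite !ext_addA (ext_addC (ext_pi _)).
Qed.

Lemma ext_scaleDr s : {morph ext_scale s : x y / ext_add x y}.
Proof.
elim/ext_ind=> x; elim/ext_ind=> y.
by rewrite !(ext_addE, ext_scaleE) /wscale map_cat.
Qed.

Lemma ext_scaleA s s' x : ext_scale s (ext_scale s' x) = ext_scale (s * s') x.
Proof.
elim/ext_ind: x => w; rewrite !ext_scaleE /wscale -map_comp.
by congr ext_pi; apply: eq_map => p /=; rewrite mulrA.
Qed.

Lemma ext_scale1 : left_id 1 ext_scale.
Proof.
elim/ext_ind=> w; rewrite ext_scaleE /wscale; congr ext_pi.
by rewrite -[RHS]map_id; apply: eq_map => -[m s] /=; rewrite mul1r.
Qed.

Lemma ext_scale0 x : ext_scale 0 x = ext_pi [::].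
Proof.
elim/ext_ind: x => w; rewrite ext_scaleE.
elim: w => //= p w IH; rewrite ext_consE IH mul0r.
by rewrite (ext_pi_eq (tens_zero _)) ext_add0.
Qed.

Lemma ext_addN : left_inverse (ext_pi [::]) ext_opp ext_add.
Proof.
move=> x; rewrite -{2}[x]ext_scale1 /ext_opp -ext_scaleDl addNr.
exact: ext_scale0.
Qed.

HB.instance Definition _ :=
  GRing.isZmodule.Build ext ext_addA ext_addC ext_add0 ext_addN.
HB.instance Definition _ :=
  GRing.Zmodule_isLmodule.Build S ext ext_scaleA ext_scale1
    ext_scaleDr ext_scaleDl.

(* The grading of a tensor product of graded modules. *)
Definition ext_hom (homM : int -> M -> Prop) (homS : int -> S -> Prop)
    (n : int) (x : ext) : Prop :=
  exists2 w : seq (M * S), x = ext_pi w &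
    forall p, p \in w ->
      exists a b : int, [/\ a + b = n, homM a p.1 & homS b p.2].

End ExtensionOfScalars.

Section ExtensionMap.
Variables (R S : comNzRingType) (phi : {rmorphism R -> S}).
Variables (M N : lmodType R) (f : {linear M -> N}).

Definition wmap (w : seq (M * S)) : seq (N * S) := [seq (f p.1, p.2) | p <- w].

(* f (x) id *)
Definition ext_map (x : ext phi M) : ext phi N := ext_pi phi (wmap (repr x)).

Lemma tens_wmap w1 w2 :
  tens_eq phi w1 w2 -> tens_eq phi (wmap w1) (wmap w2).
Proof.
elim=> {w1 w2} [w|w1 w2 _|w1 w2 w3 _ h1 _ h2|w1 w2 w1' w2' _ h1 _ h2|w1 w2|m
  |m m' t|m t t'|r m t].
- exact: tens_refl.
- exact: tens_sym.
- exact: tens_trans h1 h2.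
- by rewrite /wmap !map_cat; apply: tens_cat.
- by rewrite /wmap !map_cat; apply: tens_comm.
- exact: tens_zero.
- by rewrite /= linearD; apply: tens_addl.
- exact: tens_addr.
- by rewrite /= linearZ; apply: tens_bal.
Qed.

Lemma ext_mapE w : ext_map (ext_pi phi w) = ext_pi phi (wmap w).
Proof. by apply/ext_pi_eq/tens_wmap; apply: ext_reprP. Qed.

Lemma ext_map_is_linear : linear ext_map.
Proof.
move=> s; elim/ext_ind=> x; elim/ext_ind=> y.
have -> : s *: ext_pi phi x + ext_pi phi y = ext_pi phi (wscale s x ++ y).
  by rewrite -ext_addE -ext_scaleE.
rewrite !ext_mapE.
have -> : wmap (wscale s x ++ y) = wscale s (wmap x) ++ wmap y.
  by rewrite /wmap /wscale map_cat -!map_comp.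
by rewrite -ext_addE -ext_scaleE.
Qed.

HB.instance Definition _ :=
  GRing.isLinear.Build S (ext phi M) (ext phi N) _ ext_map ext_map_is_linear.

End ExtensionMap.
Arguments ext_map {R S} phi {M N} f x.

Section RestrictionOfScalars.
Variables (R S : comNzRingType) (phi : {rmorphism R -> S}).

Definition restr of {rmorphism R -> S} := fun N : lmodType S => N : Type.

Section Module.
Variable N : lmodType S.
HB.instance Definition _ := GRing.Zmodule.copy (restr phi N) N.

Definition restr_scale (r : R) (x : restr phi N) : restr phi N :=
  phi r *: (x : N).

Lemma restr_scaleA a b x :
  restr_scale a (restr_scale b x) = restr_scale (a * b) x.
Proof. by rewrite /restr_scale scalerA rmorphM. Qed.
Lemma restr_scale1 : left_id 1 restr_scale.
Proof. by move=> x; rewrite /restr_scale rmorph1 scale1r. Qed.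
Lemma restr_scaleDr : right_distributive restr_scale +%R.
Proof. by move=> a x y; apply: scalerDr. Qed.
Lemma restr_scaleDl x : {morph restr_scale^~ x : a b / a + b}.
Proof. by move=> a b; rewrite /restr_scale rmorphD scalerDl. Qed.

HB.instance Definition _ :=
  GRing.Zmodule_isLmodule.Build R (restr phi N) restr_scaleA restr_scale1
    restr_scaleDr restr_scaleDl.
End Module.

Section Map.
Variables (N N' : lmodType S) (f : {linear N -> N'}).
Definition restr_map (x : restr phi N) : restr phi N' := f x.
Lemma restr_map_is_linear : linear restr_map.
Proof. by move=> r x y; apply: linearP. Qed.
HB.instance Definition _ :=
  GRing.isLinear.Build R (restr phi N) (restr phi N') _ restr_map
    restr_map_is_linear.
End Map.
End RestrictionOfScalars.
Arguments restr_map {R S} phi {N N'} f x.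

(* A cohomologically graded sequence of graded modules; [chom i n x] says that
   the element x of homological degree i is homogeneous of quantum degree n
   (0 is homogeneous of every degree).  The identities a complex satisfies
   (d d = 0, additivity of degrees) are facts about the complexes defined
   below; stating that two complexes are homotopy equivalent does not use
   them. *)
Record gcomplex (A : comNzRingType) := GComplex {
  cterm : int -> lmodType A;
  chom : forall i, int -> cterm i -> Prop;
  cdiff : forall i, {linear cterm i -> cterm (i + 1)} }.

Definition preserves_degree (U V : Type) (homU : int -> U -> Prop)
    (homV : int -> V -> Prop) (f : U -> V) : Prop :=
  forall n x, homU n x -> homV n (f x).

(* f : C -> D with homotopy inverse g, by homotopies H on C and K on D; all of
   them A-linear and of quantum degree 0. *)
Definition homotopy_equivalent (A : comNzRingType) (C D : gcomplex A) : Prop :=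
  exists (f : forall i, {linear cterm C i -> cterm D i})
         (g : forall i, {linear cterm D i -> cterm C i})
         (H : forall i, {linear cterm C (i + 1) -> cterm C i})
         (K : forall i, {linear cterm D (i + 1) -> cterm D i}),
  [/\ forall i, [/\ preserves_degree (@chom _ C i) (@chom _ D i) (f i),
        preserves_degree (@chom _ D i) (@chom _ C i) (g i),
        preserves_degree (@chom _ C (i + 1)) (@chom _ C i) (H i) &
        preserves_degree (@chom _ D (i + 1)) (@chom _ D i) (K i)],
      forall i x, f (i + 1) (cdiff C i x) = cdiff D i (f i x),
      forall i x, g (i + 1) (cdiff D i x) = cdiff C i (g i x),
      forall i (x : cterm C (i + 1)), g (i + 1) (f (i + 1) x) - x =
        cdiff C i (H i x) + H (i + 1) (cdiff C (i + 1) x) &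
      forall i (y : cterm D (i + 1)), f (i + 1) (g (i + 1) y) - y =
        cdiff D i (K i y) + K (i + 1) (cdiff D (i + 1) y)].

Definition gshift (T : Type) (m : int) (hom : int -> T -> Prop) :
  int -> T -> Prop := fun n => hom (n - m).

Definition cext (R S : comNzRingType) (phi : {rmorphism R -> S})
    (homS : int -> S -> Prop) (C : gcomplex R) : gcomplex S :=
  @GComplex S (fun i => ext phi (cterm C i))
    (fun i => ext_hom (@chom _ C i) homS)
    (fun i => ext_map phi (cdiff C i)).

Definition crestr (R S : comNzRingType) (phi : {rmorphism R -> S})
    (C : gcomplex S) : gcomplex R :=
  @GComplex R (fun i => restr phi (cterm C i)) (fun i => @chom _ C i)
    (fun i => restr_map phi (cdiff C i)).

(* Pointed oriented knot diagrams, as signed Gauss codes.  Start at the base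
   point and follow the orientation: one passes n.*2 times through one of the n
   crossings, and the base point and these passages cut the knot into edges
   0, ..., n.*2.  Edge p enters passage p, edge p.+1 leaves it, and the last
   edge is followed by edge 0 at the base point. *)
Section Diagrams.
Variables (n : nat) (visit : 'I_n * bool -> 'I_n.*2) (pos : pred 'I_n).

Definition edge := 'I_n.*2.+1.
Definition ein (p : 'I_n.*2) : edge := widen_ord (leqnSn _) p.
Definition eout (p : 'I_n.*2) : edge := lift ord0 p.

Definition linked (T : eqType) (s : seq (T * T)) : rel T :=
  [rel x y | ((x, y) \in s) || ((y, x) \in s)].

(* (e, true) and (e, false) are the left and right hand sides of the edge e.
   Draw a crossing with both strands going up, a from bottom left to top right
   and b from bottom right to top left: a is the overstrand exactly when the
   crossing is positive.  The pairs list the sides that meet in the west, east,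
   north and south corners. *)
Definition corners_at (c : 'I_n) : seq ((edge * bool) * (edge * bool)) :=
  let a := visit (c, pos c) in let b := visit (c, ~~ pos c) in
  [:: ((ein a, true), (eout b, true)); ((ein b, false), (eout a, false));
      ((eout a, true), (eout b, false)); ((ein a, false), (ein b, true))].

Definition corners : seq ((edge * bool) * (edge * bool)) :=
  [:: ((ord_max, true), (ord0, true)); ((ord_max, false), (ord0, false))]
  ++ flatten [seq corners_at c | c <- enum 'I_n].

Definition regions : nat := n_comp (linked corners) predT.

End Diagrams.

(* [visit (c, true)] and [visit (c, false)] are the over- and the underpassage
   at the crossing c.  A code comes from a diagram on the sphere iff the surface
   it determines, with n + 1 vertices (the crossings and the base point),
   2n + 1 edges and the regions as faces, has Euler characteristic 2. *)
Record knot_diagram := KnotDiagram {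
  ncross : nat;
  visit : 'I_ncross * bool -> 'I_ncross.*2;
  positive : pred 'I_ncross;
  visit_inj : injective visit;
  planar : regions visit positive = ncross.+2 }.

Section Resolutions.
Variable D : knot_diagram.
Let n := ncross D.

Definition n_pos : nat := #|[pred c | @positive D c]|.
Definition n_neg : nat := #|[pred c | ~~ @positive D c]|.

Definition over_in (c : 'I_n) : edge n := ein (visit (c, true)).
Definition over_out (c : 'I_n) : edge n := eout (visit (c, true)).
Definition under_in (c : 'I_n) : edge n := ein (visit (c, false)).
Definition under_out (c : 'I_n) : edge n := eout (visit (c, false)).

(* A complete resolution is the set v of its 1-resolved crossings. *)
Definition arcs_at (v : {set 'I_n}) (c : 'I_n) : seq (edge n * edge n) :=
  if (c \in v) == @positive D c
  then [:: (over_in c, under_in c); (over_out c, under_out c)]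
  else [:: (over_in c, under_out c); (under_in c, over_out c)].

Definition arcs (v : {set 'I_n}) : seq (edge n * edge n) :=
  (ord_max, ord0) :: flatten [seq arcs_at v c | c <- enum 'I_n].

Definition circle (v : {set 'I_n}) (e : edge n) : {set edge n} :=
  [set f | connect (linked (arcs v)) e f].

Definition circles (v : {set 'I_n}) : {set {set edge n}} :=
  [set circle v e | e : edge n].

Definition hdeg (v : {set 'I_n}) : int := #|v|%:Z - n_neg%:Z.

(* The pair (v, L) stands for the tensor product over the circles of v of X
   (circles in L) and of 1 (the others).  These are the elements of the basis
   of A^{(x)(k+1)} given by the basis 1, X of A. *)
Definition label := ({set 'I_n} * {set {set edge n}})%type.

Definition estate (i : int) : Type :=
  {x : label | (x.2 \subset circles x.1) && (hdeg x.1 == i)}.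
HB.instance Definition _ i := Finite.on (estate i).

(* degree of (v, L) in A{1}^{(x)(k+1)}{r + n_+ - 2 n_-} *)
Definition qdeg (x : label) : int :=
  #|circles x.1|%:Z - 2 * #|x.2|%:Z
    + (#|x.1|%:Z + n_pos%:Z - 2 * n_neg%:Z).

End Resolutions.

(* A rank 2 Frobenius system with counit 1 |-> 0, X |-> 1 is
   A = R[X] / (X^2 - h X - t) with Delta(1) = 1(x)X + X(x)1 - h 1(x)1 and
   Delta(X) = X(x)X + t 1(x)1.  The grading of R is recorded by its homogeneous
   elements. *)
Record frobenius_system := FrobeniusSystem {
  fbase : comNzRingType;
  fh : fbase;
  ft : fbase;
  fhom : int -> fbase -> Prop }.

Section FrobeniusAlgebra.
Variable F : frobenius_system.
Let R := fbase F.
Let h : R := fh F.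
Let t : R := ft F.

Definition fpoly : {poly R} := 'X^2 - h *: 'X - t%:P.

Definition falg := {poly %/ fpoly}.
HB.instance Definition _ := GRing.ComNzRing.on falg.
HB.instance Definition _ := GRing.Algebra.on falg.

Definition fX : falg := qpolyX fpoly.

Lemma size_fpoly : size fpoly = 3%N.
Proof.
rewrite /fpoly -addrA size_polyDl size_polyXn // -opprD size_polyN.
rewrite (leq_ltn_trans (size_polyD _ _)) // gtn_max.
rewrite (leq_ltn_trans (size_scale_leq _ _)) ?size_polyX //.
by rewrite (leq_ltn_trans (size_polyC_leq1 _)).
Qed.

Lemma monic_fpoly : fpoly \is monic.
Proof.
rewrite monicE lead_coefE size_fpoly /fpoly !coefB coefZ coefXn coefX coefC /=.
by rewrite mulr0 !subr0.
Qed.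

Lemma mk_monic_fpoly : mk_monic fpoly = fpoly.
Proof. by rewrite /mk_monic size_fpoly monic_fpoly. Qed.

Lemma falgE (a : falg) : (a : {poly R}) = (a`_0)%:P + a`_1 *: 'X.
Proof.
have sa : (size a <= 2)%N.
  have e : size (mk_monic fpoly) = 3%N by rewrite mk_monic_fpoly size_fpoly.
  by rewrite -ltnS -e size_mk_monic.
apply/polyP => -[|[|k]]; rewrite coefD coefC coefZ coefX /=.
- by rewrite mulr0 addr0.
- by rewrite mulr1 add0r.
- by rewrite mulr0 addr0 nth_default // (leq_trans sa).
Qed.

Lemma fXE : (fX : {poly R}) = 'X.
Proof. by rewrite qpolyXE ?size_fpoly ?monic_fpoly. Qed.

(* deg X = -2 *)
Definition falg_hom (n : int) (a : falg) : Prop :=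
  @fhom F n a`_0 /\ @fhom F (n + 2) a`_1.

Lemma fX2 : fX * fX = h *: fX + t *: 1 :> falg.
Proof.
apply: val_inj.
change (Pdiv.CommonRing.rmodp ((fX : {poly R}) * (fX : {poly R})) (mk_monic fpoly) =
  h *: (fX : {poly R}) + t *: 1).
rewrite fXE mk_monic_fpoly.
have e : 'X * 'X = 1 * fpoly + (h *: 'X + t%:P) :> {poly R}.
  by rewrite mul1r /fpoly -!mul_polyC; ring.
rewrite e Pdiv.RingMonic.rmodp_addl_mul_small ?monic_fpoly //.
  by rewrite -alg_polyC.
rewrite size_fpoly (leq_ltn_trans (size_polyD _ _)) // gtn_max.
rewrite (leq_ltn_trans (size_scale_leq _ _)) ?size_polyX //.
by rewrite (leq_ltn_trans (size_polyC_leq1 _)).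
Qed.

Lemma falg_coefD (a b : falg) k : (a + b : falg)`_k = a`_k + b`_k.
Proof. exact: coefD. Qed.
Lemma falg_coefZ r (a : falg) k : (r *: a : falg)`_k = r * a`_k.
Proof. exact: coefZ. Qed.
Lemma falg_coef1 k : (1 : falg)`_k = (k == 0%N)%:R.
Proof. exact: coef1. Qed.
Lemma falg_coefX k : fX`_k = (k == 1%N)%:R.
Proof. by have := congr1 (fun p : {poly R} => p`_k) fXE; rewrite coefX. Qed.

Lemma falg_eta (a : falg) : a = a`_0 *: 1 + a`_1 *: fX.
Proof.
apply: val_inj.
change ((a : {poly R}) = a`_0 *: 1 + a`_1 *: (fX : {poly R})).
by rewrite fXE alg_polyC; exact: falgE.
Qed.

Lemma falg_coefM (a : falg) (i k : bool) : (a * fX ^+ i : falg)`_k =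
  match i, k with
  | false, false => a`_0
  | false, true => a`_1
  | true, false => a`_1 * t
  | true, true => a`_0 + a`_1 * h
  end.
Proof.
case: i; last by rewrite expr0 mulr1; case: k.
rewrite expr1 {1}[a]falg_eta mulrDl -!scalerAl mul1r fX2.
rewrite !(falg_coefD, falg_coefZ, falg_coefX, falg_coef1).
by case: k; rewrite /= ?(mulr0, mulr1, addr0, add0r).
Qed.

(* Structure constants in the basis 1, X, where false stands for 1 and true for
   X: the coefficient of e_k in a e_i (a in A) and in e_i e_j, and that of
   e_j (x) e_k in Delta(e_i). *)
Definition actc (a : falg) (i k : bool) : R := (a * fX ^+ i : falg)`_k.

Definition mulc (i j k : bool) : R := actc (fX ^+ i) j k.

Definition comulc (i j k : bool) : R :=
  match i, j, k with
  | false, false, false => - h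
  | false, false, true | false, true, false => 1
  | true, false, false => t
  | true, true, true => 1
  | _, _, _ => 0
  end.

Lemma actcE a i k : actc a i k =
  match i, k with
  | false, false => a`_0
  | false, true => a`_1
  | true, false => a`_1 * t
  | true, true => a`_0 + a`_1 * h
  end.
Proof. exact: falg_coefM. Qed.

Lemma actcM a b i k : actc (a * b) i k = \sum_j actc b i j * actc a j k.
Proof.
rewrite /actc -mulrA; move: (b * _) => c.
rewrite big_bool {1}[c]falg_eta mulrDr -!scalerAr falg_coefD !falg_coefZ mulr1.
by rewrite addrC; congr (_ * _ + _ * _); rewrite ?mulr1.
Qed.

Lemma actc1 i k : actc 1 i k = (i == k)%:R.
Proof.
rewrite actcE !falg_coef1.
by case: i; case: k; rewrite /= ?mul0r ?addr0.
Qed.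

Lemma actcD a b i k : actc (a + b) i k = actc a i k + actc b i k.
Proof. by rewrite /actc mulrDl falg_coefD. Qed.

Lemma mulcE i j k : mulc i j k =
  match i, j, k with
  | false, _, _ => (j == k)%:R
  | _, false, _ => (i == k)%:R
  | true, true, false => t
  | true, true, true => h
  end.
Proof.
rewrite /mulc; case: i; last by rewrite expr0 actc1; case: j.
rewrite expr1 actcE !falg_coefX.
by case: j; case: k; rewrite /= ?(mul0r, mul1r, add0r).
Qed.

Lemma act_mulcl a i j k :
  \sum_l actc a i l * mulc l j k = \sum_l mulc i j l * actc a l k.
Proof.
by rewrite !big_bool !mulcE !actcE; case: i; case: j; case: k => /=; ring.
Qed.

Lemma act_mulcr a i j k :
  \sum_l actc a j l * mulc i l k = \sum_l mulc i j l * actc a l k.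
Proof.
by rewrite !big_bool !mulcE !actcE; case: i; case: j; case: k => /=; ring.
Qed.

Lemma act_comulcl a i j k :
  \sum_l actc a i l * comulc l j k = \sum_l comulc i l k * actc a l j.
Proof. by rewrite !big_bool !actcE; case: i; case: j; case: k => /=; ring. Qed.

Lemma act_comulcr a i j k :
  \sum_l actc a i l * comulc l j k = \sum_l comulc i j l * actc a l k.
Proof. by rewrite !big_bool !actcE; case: i; case: j; case: k => /=; ring. Qed.

End FrobeniusAlgebra.

Section CircleTheory.
Variable D : knot_diagram.
Let n := ncross D.
Implicit Types (v w : {set 'I_n}) (e f : edge n) (c : 'I_n).

Lemma linked_sym (T : eqType) (s : seq (T * T)) : symmetric (linked s).
Proof. by move=> x y; rewrite /linked /= orbC. Qed.

Lemma linked_cat (T : eqType) (s1 s2 : seq (T * T)) x y :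
  linked (s1 ++ s2) x y = linked s1 x y || linked s2 x y.
Proof. by rewrite /linked /= !mem_cat orbACA. Qed.

Lemma arcsP v e f :
  reflect (linked [:: (ord_max, ord0)] e f \/ exists c, linked (arcs_at v c) e f)
    (linked (arcs v) e f).
Proof.
have -> : linked (arcs v) e f = linked [:: (ord_max, ord0)] e f
    || linked (flatten [seq arcs_at v c | c <- enum 'I_n]) e f.
  exact: (linked_cat [:: _]).
apply: (iffP idP) => [/orP[|]|[->//|[c h]]]; first by left.
  move=> h; right; move: h; rewrite {1}/linked /= => /orP[] /flatten_mapP[c _ h];
    by exists c; rewrite /linked /= h ?orbT.
apply/orP; right; move: h; rewrite /linked /= => /orP[] h; apply/orP;
  [left|right]; apply/flatten_mapP; exists c => //; by rewrite mem_enum.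
Qed.

Lemma circle_connect v e f :
  (circle v e == circle v f) = connect (linked (arcs v)) e f.
Proof.
apply/eqP/idP => [/setP/(_ f)|h]; first by rewrite !inE connect0.
apply/setP=> x; rewrite !inE; apply: (same_connect _ h).
exact/sym_connect_sym/linked_sym.
Qed.

Lemma circle_arc v e f : linked (arcs v) e f -> circle v e = circle v f.
Proof. by move=> h; apply/eqP; rewrite circle_connect connect1. Qed.

Lemma mem_circle v e : e \in circle v e.
Proof. by rewrite inE connect0. Qed.

Lemma circle_in v e : circle v e \in circles v.
Proof. exact: imset_f. Qed.

Definition touched v c : {set {set edge n}} :=
  [set circle v (over_in c); circle v (over_out c)].

Lemma circle_endpoint v w c e f :
  linked (arcs_at w c) e f -> circle v e \in touched v c.
Proof.
move=> lef.
have under_t : circle v (under_in c) \in touched v c /\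
               circle v (under_out c) \in touched v c.
  have l x y : (x, y) \in arcs_at v c -> circle v x = circle v y.
    move=> h; apply/circle_arc/arcsP; right; exists c.
    by rewrite /linked /= h.
  move: l; rewrite /arcs_at; case: ifP => _ l.
    rewrite -(l (over_in c) (under_in c)) ?inE ?eqxx //.
    by rewrite -(l (over_out c) (under_out c)) ?inE ?eqxx ?orbT.
  rewrite -(l (over_in c) (under_out c)) ?inE ?eqxx //.
  by rewrite (l (under_in c) (over_out c)) ?inE ?eqxx ?orbT.
have [ui uo] := under_t.
have oi : circle v (over_in c) \in touched v c by rewrite set21.
have oo : circle v (over_out c) \in touched v c by rewrite set22.
have : e \in [:: over_in c; over_out c; under_in c; under_out c].
  move: lef; rewrite /linked /= /arcs_at.
  case: ifP => _; rewrite !inE !xpair_eqE;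
    by do 4?case: (e == _); rewrite ?orbT ?andbF.
by rewrite !inE => /or4P[] /eqP->; rewrite -?in_set2.
Qed.

Section Flip.
Variables (v w : {set 'I_n}) (c : 'I_n).
Hypothesis vw : forall j, j != c -> (j \in v) = (j \in w).

Lemma arcs_flip e f : circle v e \notin touched v c ->
  linked (arcs v) e f = linked (arcs w) e f.
Proof.
move=> ne; apply/arcsP/arcsP => -[h|[j h]]; first [by left | right; exists j];
  have jc : j != c by apply: contraNneq ne => jc; move: h; rewrite jc;
    apply: circle_endpoint.
  by move: h; rewrite /arcs_at vw.
by move: h; rewrite /arcs_at vw.
Qed.

Lemma connect_flip e f : circle v e \notin touched v c ->
  connect (linked (arcs v)) e f = connect (linked (arcs w)) e f.
Proof.
move: arcs_flip (@circle_arc v).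
move: (touched v c) (circle v) (linked (arcs v)) (linked (arcs w)).
move=> T C rv rw flip arc ne; apply/connectP/connectP => -[p pp ->] {f}.
  exists p => //; elim: p e ne pp => //= f p IH e ne /andP[ef pp].
  by rewrite -flip // ef /=; apply: IH => //; rewrite -(arc e).
exists p => //; elim: p e ne pp => //= f p IH e ne /andP[].
by rewrite -flip // => ef pp; rewrite ef /=; apply: IH => //; rewrite -(arc e).
Qed.

Lemma circle_flip e : circle v e \notin touched v c -> circle w e = circle v e.
Proof.
by move=> ne; apply/setP=> f; rewrite [LHS]in_set [RHS]in_set connect_flip.
Qed.

Lemma touched_flip e :
  circle v e \notin touched v c -> circle w e \notin touched w c.
Proof.
move=> ne; have ee := circle_flip ne; apply/negP => h; move/negP: ne; apply.
have [x xv ex] : exists2 x, circle v x \in touched v c & circle w e = circle w x.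
  move/set2P: h => [->|->].
    by exists (over_in c); [exact: set21 | reflexivity].
  by exists (over_out c); [exact: set22 | reflexivity].
have : x \in circle v e by rewrite -ee ex; exact: mem_circle.
by rewrite in_set -circle_connect => /eqP ->.
Qed.

End Flip.
End CircleTheory.

Section Chains.
Variables (F : frobenius_system) (D : knot_diagram).
Let n := ncross D.
Let R := fbase F.
Let A := falg F.
Implicit Types (v w : {set 'I_n}) (L N : {set {set edge n}}) (x y z : label D).

Definition base_circle v : {set edge n} := circle v ord0.

(* The coefficient of y in a x: the algebra A acts on the factor of the circle
   through the base point. *)
Definition act_coef (a : A) x y : R :=
  let g := base_circle x.1 in
  if (y.1 == x.1) && (y.2 :\ g == x.2 :\ g)
  then actc a (g \in x.2) (g \in y.2) else 0.

(* The circles g1, g2 merge into d1 = d2, or the circle g1 = g2 splits into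
   d1, d2; this is the coefficient of the labelling N in the image of L. *)
Definition local_coef (g1 g2 d1 d2 : {set edge n}) L N : R :=
  if L :\: [set g1; g2] == N :\: [set d1; d2] then
    match g1 == g2, d1 == d2 with
    | false, true => @mulc F (g1 \in L) (g2 \in L) (d1 \in N)
    | true, false => @comulc F (g1 \in L) (d1 \in N) (d2 \in N)
    | _, _ => 0
    end
  else 0.

(* The edge of the cube from v to c |: v.  The two arcs at c lie on the circles
   through [over_in c] and [over_out c], both before and after.  By planarity
   their number changes by 1: the last case of [local_coef] does not occur. *)
Definition edge_coef v c L N : R :=
  local_coef (circle v (over_in c)) (circle v (over_out c))
    (circle (c |: v) (over_in c)) (circle (c |: v) (over_out c)) L N.

Definition diff_coef x y : R :=
  \sum_(c | (c \notin x.1) && (y.1 == c |: x.1))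
     (-1) ^+ #|[set j in x.1 | (j < c)%N]| * edge_coef x.1 c x.2 y.2.

(* The direct sum of the A^{(x)(k+1)} over the resolutions in homological degree
   i; f e is the coefficient of the basis element e. *)
Definition kterm (i : int) : Type := {ffun estate D i -> R}.
HB.instance Definition _ i := GRing.Zmodule.on (kterm i).

Definition kscale i (a : A) (f : kterm i) : kterm i :=
  [ffun y => \sum_x act_coef a (val x) (val y) * f x].

Definition kdiff i (f : kterm i) : kterm (i + 1) :=
  [ffun y => \sum_x diff_coef (val x) (val y) * f x].

Definition khom i (m : int) (f : kterm i) : Prop :=
  forall x : estate D i, @fhom F (m - qdeg (val x)) (f x).

Definition wf i x := (x.2 \subset circles x.1) && (hdeg x.1 == i).

Definition put (g : {set edge n}) (b : bool) L := if b then g |: L else L :\ g.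

Lemma putD1 g b L : put g b L :\ g = L :\ g.
Proof. by apply/setP=> e; case: b; rewrite !inE; case: (e == g). Qed.

Lemma in_put g b L : (g \in put g b L) = b.
Proof. by case: b; rewrite !inE eqxx. Qed.

Lemma put_eq g L N : (N :\ g == L :\ g) = (N == put g (g \in N) L).
Proof.
apply/eqP/eqP => [h|->]; last by rewrite putD1.
apply/setP=> e; move/setP/(_ e): h; rewrite !inE.
by case gN: (g \in N); rewrite !inE; case: eqP => //= ->.
Qed.

Lemma sum_put i v L g (G : label D -> R) : wf i (v, L) -> g \in circles v ->
  \sum_(y : estate D i | ((val y).1 == v) && ((val y).2 :\ g == L :\ g))
     G (val y) = \sum_b G (v, put g b L).
Proof.
move=> /andP[/= Lv hv] gv.
have wfp b : wf i (v, put g b L).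
  rewrite /wf /= hv andbT; case: b; rewrite /put.
    by rewrite subUset sub1set gv.
  by rewrite (subset_trans (subD1set _ _)).
rewrite (reindex (fun b => Sub (v, put g b L) (wfp b) : estate D i)) /=.
  by apply: eq_big => b; rewrite /= ?eqxx ?putD1 ?eqxx.
exists (fun y : estate D i => g \in (val y).2) => [b _|y].
  by rewrite /= in_put.
rewrite inE put_eq => /andP[/eqP e1 /eqP e2]; apply: val_inj => /=.
by rewrite -e2 -e1 -surjective_pairing.
Qed.

Lemma sum_act_l i a (x : estate D i) (G : label D -> R) :
  let g := base_circle (val x).1 in
  \sum_(y : estate D i) act_coef a (val x) (val y) * G (val y) =
  \sum_b actc a (g \in (val x).2) b * G ((val x).1, put g b (val x).2).
Proof.
move=> g; rewrite (bigID (fun y : estate D i =>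
  ((val y).1 == (val x).1) && ((val y).2 :\ g == (val x).2 :\ g))) /=.
rewrite [X in _ + X]big1 ?addr0; last first.
  by move=> y /negPf h; rewrite /act_coef h mul0r.
have wfv : wf i ((val x).1, (val x).2).
  by rewrite -surjective_pairing; exact: (valP x).
have e := sum_put (fun z => actc a (g \in (val x).2) (g \in z.2) * G z) wfv (circle_in _ _).
rewrite -/g /= in e.
transitivity (\sum_b (fun z => actc a (g \in (val x).2) (g \in z.2) * G z) ((val x).1, put g b (val x).2)).
  by rewrite -e; apply: eq_bigr => y h; rewrite /act_coef h.
by apply: eq_bigr => b _; rewrite /= in_put.
Qed.

Lemma act_coefC a x y : act_coef a x y =
  let g := base_circle y.1 in
  if (x.1 == y.1) && (x.2 :\ g == y.2 :\ g)
  then actc a (g \in x.2) (g \in y.2) else 0.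
Proof.
case: x y => [v L] [w N]; rewrite /act_coef /=.
have [->|_] /= := eqVneq w v; last by [].
by rewrite [N :\ _ == _]eq_sym.
Qed.

Lemma sum_act_r i a (y : estate D i) (G : label D -> R) :
  let g := base_circle (val y).1 in
  \sum_(x : estate D i) act_coef a (val x) (val y) * G (val x) =
  \sum_b actc a b (g \in (val y).2) * G ((val y).1, put g b (val y).2).
Proof.
move=> g; rewrite (bigID (fun x : estate D i =>
  ((val x).1 == (val y).1) && ((val x).2 :\ g == (val y).2 :\ g))) /=.
rewrite [X in _ + X]big1 ?addr0; last first.
  by move=> x /negPf h; rewrite act_coefC /= h mul0r.
have wfv : wf i ((val y).1, (val y).2).
  by rewrite -surjective_pairing; exact: (valP y).
have e := sum_put (fun z => actc a (g \in z.2) (g \in (val y).2) * G z) wfv (circle_in _ _).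
rewrite -/g /= in e.
transitivity (\sum_b (fun z => actc a (g \in z.2) (g \in (val y).2) * G z) ((val y).1, put g b (val y).2)).
  by rewrite -e; apply: eq_bigr => x h; rewrite act_coefC /= h.
by apply: eq_bigr => b _; rewrite /= in_put.
Qed.

Lemma kscaleA i a b (f : kterm i) : kscale a (kscale b f) = kscale (a * b) f.
Proof.
apply/ffunP=> z; rewrite !ffunE.
under eq_bigr do rewrite ffunE mulr_sumr.
rewrite exchange_big; apply: eq_bigr => x _ /=.
under eq_bigr do rewrite mulrA [act_coef a _ _ * _]mulrC.
rewrite -mulr_suml; congr (_ * _).
rewrite (@sum_act_l i b x (fun y => act_coef a y (val z))) /=.
rewrite /act_coef /=; set g := base_circle _.
under eq_bigr do rewrite in_put putD1.
by case: ifP => _; [rewrite actcM | rewrite big1 // => j _; rewrite mulr0].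
Qed.

Lemma kscale1 i : left_id 1 (@kscale i).
Proof.
move=> f; apply/ffunP=> y; rewrite ffunE.
rewrite (bigD1 y) //= big1 ?addr0 => [|x xy].
  by rewrite /act_coef !eqxx /= actc1 eqxx mul1r.
rewrite /act_coef; case: ifP; rewrite ?mul0r // => /andP[/eqP e1].
rewrite put_eq => /eqP e2; rewrite actc1; case: eqP; rewrite ?mul0r // => e3.
case/eqP: xy; apply: val_inj => /=.
rewrite [val x]surjective_pairing [val y]surjective_pairing e1 e2 -e3.
by congr (_, _); apply/eqP; rewrite -put_eq.
Qed.

Lemma kscaleDr i : right_distributive (@kscale i) +%R.
Proof.
move=> a f g; apply/ffunP=> y; rewrite !ffunE -big_split /=.
by apply: eq_bigr => x _; rewrite ffunE mulrDr.
Qed.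

Lemma kscaleDl i f : {morph (@kscale i)^~ f : a b / a + b}.
Proof.
move=> a b; apply/ffunP=> y; rewrite !ffunE -big_split /=.
apply: eq_bigr => x _; rewrite -mulrDl; congr (_ * _).
by rewrite /act_coef /=; case: ifP => _; rewrite ?actcD ?addr0.
Qed.

HB.instance Definition _ i :=
  GRing.Zmodule_isLmodule.Build A (kterm i) (@kscaleA i) (@kscale1 i)
    (@kscaleDr i) (@kscaleDl i).

End Chains.

Section Differential.
Variables (F : frobenius_system) (D : knot_diagram).
Let n := ncross D.
Let R := fbase F.
Let A := falg F.
Implicit Types (v w : {set 'I_n}) (L N : {set {set edge n}}).

Lemma in_putN (g e : {set edge n}) b L :
  e != g -> (e \in put g b L) = (e \in L).
Proof. by move=> /negPf eg; case: b; rewrite !inE eg. Qed.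

Lemma put_setD (g : {set edge n}) b L (S : {set {set edge n}}) :
  g \in S -> put g b L :\: S = L :\: S.
Proof.
move=> gS; apply/setP=> e; rewrite /put; case: b; rewrite !inE;
by case: eqP => [->|]; rewrite ?gS.
Qed.

Lemma put_setD_eq (g : {set edge n}) b L N (S T : {set {set edge n}}) :
  g \notin S -> g \notin T ->
  (put g b L :\: S == N :\: T) =
    (b == (g \in N)) && ((L :\ g) :\: S == (N :\ g) :\: T).
Proof.
move=> gS gT; apply/eqP/andP => [h|[/eqP-> /eqP h]]; last first.
  apply/setP=> e; move/setP/(_ e): h; rewrite /put; case: ifP => gN; rewrite !inE;
  by case: eqP => [->|] //=; rewrite ?gS ?gT ?gN.
split; apply/eqP.
  by move/setP/(_ g): h; rewrite [in LHS]inE in_put gS inE gT.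
apply/setP=> e; move/setP/(_ e): h; rewrite /put; case: b; rewrite !inE;
by case: eqP => [->|] //=; rewrite ?andbF.
Qed.

Lemma edge_act_core (a : A) (g d g1 g2 d1 d2 : {set edge n}) L N :
  (g \in [set g1; g2]) = (d \in [set d1; d2]) ->
  (g \notin [set g1; g2] -> d = g) ->
  \sum_b actc a (g \in L) b * local_coef F g1 g2 d1 d2 (put g b L) N =
  \sum_b local_coef F g1 g2 d1 d2 L (put d b N) * actc a b (d \in N).
Proof.
rewrite /local_coef.
have := @act_comulcr F a; have := @act_comulcl F a.
have := @act_mulcr F a; have := @act_mulcl F a.
move: (@actc F a) (@mulc F) (@comulc F) => act mu cm mul_l mul_r cm_l cm_r.
have [gt /esym dt _|gt /esym/negbT dt /(_ isT) dg] := boolP (g \in [set g1; g2]);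
  last first.
  subst d.
  have [ng1 ng2 nd1 nd2] : [/\ g1 != g, g2 != g, d1 != g & d2 != g].
    by split; [move: gt|move: gt|move: dt|move: dt]; apply: contraNneq => <-;
      rewrite !inE eqxx ?orbT.
  rewrite !big_bool !(put_setD_eq _ _ _ gt dt).
  rewrite !(in_putN _ _ ng1) !(in_putN _ _ ng2) !(in_putN _ _ nd1).
  rewrite !(in_putN _ _ nd2) ![L :\: _ == _]eq_sym !(put_setD_eq _ _ _ dt gt).
  rewrite [(N :\ g) :\: _ == _]eq_sym.
  by case: (_ :\: _ == _); case: (g \in L); case: (g \in N) => /=;
    rewrite ?(mulr0, mul0r, addr0, add0r) 1?mulrC.
under eq_bigr do rewrite (put_setD _ _ gt).
under [RHS]eq_bigr do rewrite (put_setD _ _ dt).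
case: (L :\: [set g1; g2] == N :\: [set d1; d2]); last first.
  by rewrite !big1 // => b _; rewrite ?mulr0 ?mul0r.
case: (eqVneq g1 g2) => g12; case: (eqVneq d1 d2) => d12;
  try by rewrite !big1 // => b _; rewrite ?mulr0 ?mul0r.
- have gE : g = g1 by move: gt; rewrite -g12 !inE orbb => /eqP.
  subst g; under eq_bigr do rewrite in_put.
  move: dt; rewrite !inE => /orP[] /eqP ->.
    under [RHS]eq_bigr do rewrite in_put in_putN 1?eq_sym //.
    exact: cm_l.
  under [RHS]eq_bigr do rewrite in_put in_putN //.
  exact: cm_r.
have dE : d = d1 by move: dt; rewrite -d12 !inE orbb => /eqP.
subst d; under [RHS]eq_bigr do rewrite in_put.
move: gt; rewrite !inE => /orP[] /eqP ->.
  under eq_bigr do rewrite in_put in_putN 1?eq_sym //.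
  exact: mul_l.
under eq_bigr do rewrite in_put in_putN //.
exact: mul_r.
Qed.

Lemma edge_act (a : A) v c L N : c \notin v ->
  let g := base_circle v in let d := base_circle (c |: v) in
  \sum_b actc a (g \in L) b * edge_coef F v c (put g b L) N =
  \sum_b edge_coef F v c L (put d b N) * actc a b (d \in N).
Proof.
move=> cv g d.
have vw j : j != c -> (j \in v) = (j \in c |: v).
  by move=> /negPf jc; rewrite !inE jc.
have wv j : j != c -> (j \in c |: v) = (j \in v) by move=> /vw.
apply: edge_act_core => [|gt]; last exact: (circle_flip vw gt).
apply/idP/idP; apply: contraTT => h.
  exact: (@touched_flip D _ v c wv ord0 h).
exact: (@touched_flip D v _ c vw ord0 h).
Qed.

Lemma kdiff_is_linear i : linear (@kdiff F D i).
Proof.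
move=> a f f'.
have kadd (f1 f2 : kterm F D i) : kdiff (f1 + f2) = kdiff f1 + kdiff f2.
  apply/ffunP=> y; rewrite !ffunE -big_split /=.
  by apply: eq_bigr => x _; rewrite ffunE mulrDr.
rewrite kadd; congr (_ + _); apply/ffunP=> z; rewrite !ffunE.
under eq_bigr do rewrite ffunE mulr_sumr.
under [RHS]eq_bigr do rewrite ffunE mulr_sumr.
rewrite exchange_big [RHS]exchange_big; apply: eq_bigr => x _ /=.
under eq_bigr do rewrite mulrA [diff_coef _ _ _ * _]mulrC.
under [RHS]eq_bigr do rewrite mulrA.
rewrite -!mulr_suml; congr (_ * _).
rewrite (sum_act_l a x (fun y => diff_coef F y (val z))).
rewrite (sum_act_r a z (fun y => diff_coef F (val x) y)) /diff_coef /=.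
under eq_bigr do rewrite mulr_sumr.
under [RHS]eq_bigr do rewrite mulr_sumr.
rewrite exchange_big [RHS]exchange_big /=; apply: eq_bigr => c /andP[cv /eqP zE].
under eq_bigr do rewrite mulrCA.
under [RHS]eq_bigr do rewrite mulrCA.
rewrite -!mulr_sumr; congr (_ * _).
rewrite zE edge_act //.
by apply: eq_bigr => b _; rewrite mulrC.
Qed.

HB.instance Definition _ i :=
  GRing.isLinear.Build A (kterm F D i) (kterm F D (i + 1)) _ (@kdiff F D i)
    (@kdiff_is_linear i).

Definition khovanov_complex : gcomplex A :=
  @GComplex A (fun i => kterm F D i) (@khom F D) (@kdiff F D).

End Differential.

(* Z[h, t] as Z[h][t], with deg h = -2 and deg t = -4 *)
Definition univ_system : frobenius_system :=
  @FrobeniusSystem {poly {poly int}} ('X)%:P 'X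
    (fun n p => forall i j : nat,
       p`_j`_i != 0 -> n = - (2 * i%:Z + 4 * j%:Z)).

Notation A_univ := (falg univ_system).

Definition C_univ (D : knot_diagram) : gcomplex A_univ :=
  khovanov_complex univ_system D.

(* Z[G] with deg G = -2; here h = - G and t = 0 *)
Definition ZG_system : frobenius_system :=
  @FrobeniusSystem {poly int} (- 'X) 0
    (fun n p => forall i : nat, p`_i != 0 -> n = - (2 * i%:Z)).

Notation A_ZG := (falg ZG_system).

Lemma fpoly_ZG : fpoly ZG_system = 'X^2 + ('X)%:P * 'X.
Proof. by rewrite /fpoly polyC0 subr0 scaleNr opprK mul_polyC. Qed.

Definition X_ideal : pred A_ZG :=
  fun a => `[< exists b : A_ZG, a = b * fX ZG_system >].

Lemma X_ideal_closed : idealr_closed X_ideal.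
Proof.
split=> [||a x y].
- by apply/asboolP; exists 0; rewrite mul0r.
- apply/asboolP => -[b].
  move=> /(congr1 (fun a : A_ZG => a`_0)).
  rewrite (falg_coefM b true false) mulr0.
  by rewrite (@falg_coef1 ZG_system) => /eqP; rewrite oner_eq0.
move=> /asboolP[b ->] /asboolP[b' ->].
by apply/asboolP; exists (a * b + b'); rewrite mulrDl mulrA.
Qed.
HB.instance Definition _ := isIdealr.Build A_ZG X_ideal X_ideal_closed.

Notation A_ZG_X := {ideal_quot (X_ideal : idealr A_ZG)}.

Definition mod_X : {rmorphism A_ZG -> A_ZG_X} := \pi_(A_ZG_X)%qT.

Definition A_ZG_X_hom (n : int) (x : A_ZG_X) : Prop :=
  exists2 a : A_ZG, falg_hom n a & x = mod_X a.

(* the Z[G]-module structure of A_ZG_X *)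
Definition ZG_mod_X : {rmorphism {poly int} -> A_ZG_X} :=
  mod_X \o in_alg A_ZG.

Definition bracket (D : knot_diagram) : gcomplex {poly int} :=
  crestr ZG_mod_X
    (cext mod_X (gshift (-1) A_ZG_X_hom) (khovanov_complex ZG_system D)).

Definition G_image : A_univ := 2 * fX univ_system - (fh univ_system)%:A.

Lemma G_image_comm : commr_rmorph (intr : int -> A_univ) G_image.
Proof. by move=> x; apply: mulrC. Qed.

(* the Z[G]-module structure of A_univ: G acts as 2 X - h *)
Definition ZG_A_univ : {rmorphism {poly int} -> A_univ} :=
  horner_morph G_image_comm.

Lemma ZG_A_univX : ZG_A_univ 'X = 2 * fX univ_system - (fh univ_system)%:A.
Proof. exact: horner_morphX. Qed.

(* Main.v *)
(* A resolution puts a free module over A = A_univ on the circles not containing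
   the base point: X acts on the circle through the base point, and every other
   circle c carries A[Y_c] / (Y_c^2 - h Y_c - t).  In terms of Z_c = Y_c - X the
   relation becomes Z_c^2 + G Z_c = 0 with G = 2 X - h, and Delta, rewritten in
   1 and Z_c, is the comultiplication of the system over Z[G]; the circle
   through the base point corresponds to Z = 0.  So Y_c = Z_c + X is an
   isomorphism of complexes, already before passing to homotopy. *)
Require Import Defs.
From HB Require Import structures.
From mathcomp Require Import all_boot all_algebra.
From mathcomp Require Import boolp zify ring.

Set Implicit Arguments.
Unset Strict Implicit.
Unset Printing Implicit Defensive.

Import GRing.Theory.
Local Open Scope ring_scope.

(** * Extension of scalars *)

(** Origin of G = 2X - h: over A_univ the polynomial Y^2 - hY - t factors as (Y - X)(Y - (h - X)).
    Moving the root X to 0 leaves the other root h - 2X, which is -G. The label of the base circle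
    acts as a coefficient: labellings with 1 on that circle form an A_univ-basis of C_univ, and
    reduction modulo X kills the other labellings of the bracket. Both sides are thus indexed by the
    same labellings L, and the isomorphism sends the generator L of the bracket to the product of
    the Y_c - X, c in L. Maps out of the bracket have to respect the relations of two nested tensor
    products, so they come from the universal property, applied twice. On that side the generators
    are shown to span, and both composites are tested on generators. The main difficulty is
    commutation with the differential, where each coefficient is a sum over all intermediate
    labellings. Substitution coefficients are products over circles, so the circles away from the
    crossing factor out and four identities remain: a merge or a split, with or without the base
    circle. *)

Section ExtLift.
Variables (R S : comNzRingType) (phi : {rmorphism R -> S}).
Variables (M : lmodType R) (N : lmodType S).

Definition tens (m : M) (s : S) : ext phi M := ext_pi phi [:: (m, s)].

Lemma ext_pi_sum w : ext_pi phi w = \sum_(p <- w) tens p.1 p.2.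
Proof.
elim: w => [|[m s] w IH]; first by rewrite big_nil.
by rewrite big_cons -IH ext_consE.
Qed.

Lemma tensDl m m' s : tens (m + m') s = tens m s + tens m' s.
Proof.
by rewrite /tens (ext_pi_eq (tens_addl _ _ _ _)) (ext_consE _ (m, s)).
Qed.

Lemma tensZl r m s : tens (r *: m) s = tens m (phi r * s).
Proof. exact/ext_pi_eq/tens_bal. Qed.

Lemma tensZ s m s' : s *: tens m s' = tens m (s * s').
Proof. exact: ext_scaleE. Qed.

Lemma tens0l s : tens 0 s = 0.
Proof. by apply: (@addrI _ (tens 0 s)); rewrite -tensDl !addr0. Qed.

Lemma tens_sumZ (I : finType) (P : pred I) (r : I -> R) (m : I -> M) s :
  tens (\sum_(i | P i) r i *: m i) s = \sum_(i | P i) phi (r i) *: tens (m i) s.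
Proof.
elim/big_rec2: _ => [|i x y _ <-]; first exact: tens0l.
by rewrite tensDl tensZl tensZ.
Qed.

Variable u : {linear M -> restr phi N}.

(** Universal property of extension of scalars, on words: an R-linear [u] into the restriction of
    [N] induces an S-linear map on the tensor product. *)
Definition wlift (w : seq (M * S)) : N := \sum_(p <- w) p.2 *: (u p.1 : N).

Lemma tens_wlift w1 w2 : tens_eq phi w1 w2 -> wlift w1 = wlift w2.
Proof.
rewrite /wlift.
elim=> {w1 w2} [w|w1 w2 _ ->|w1 w2 w3 _ -> _ ->|w1 w2 w1' w2' _ h1 _ h2|w1 w2|m
  |m m' t|m t t'|r m t] //; rewrite ?big_cat ?big_cons ?big_nil /= ?addr0.
- by rewrite h1 h2.
- exact: addrC.
- by rewrite scale0r.
- by rewrite linearD -scalerDr.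
- by rewrite scalerDl.
- by rewrite linearZ /= mulrC -scalerA.
Qed.

Definition ext_lift (x : ext phi M) : N := wlift (repr x).

Lemma ext_liftE w : ext_lift (ext_pi phi w) = wlift w.
Proof. exact/tens_wlift/ext_reprP. Qed.

Lemma ext_lift_tens m s : ext_lift (tens m s) = s *: (u m : N).
Proof. by rewrite ext_liftE /wlift big_seq1. Qed.

Lemma ext_lift_is_linear : linear ext_lift.
Proof.
move=> s; elim/ext_ind=> x; elim/ext_ind=> y.
have -> : s *: ext_pi phi x + ext_pi phi y = ext_pi phi (wscale s x ++ y).
  by rewrite -ext_addE -ext_scaleE.
rewrite !ext_liftE /wlift big_cat /= big_map scaler_sumr; congr (_ + _).
by apply: eq_bigr => p _; rewrite scalerA.
Qed.

HB.instance Definition _ :=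
  GRing.isLinear.Build S (ext phi M) N _ ext_lift ext_lift_is_linear.

End ExtLift.
Arguments tens {R S} phi {M} m s.

Section ExtHom.
Variables (R S : comNzRingType) (phi : {rmorphism R -> S}) (M : lmodType R).
Variables (homM : int -> M -> Prop) (homS : int -> S -> Prop).

Lemma ext_hom_tens a b m s : homM a m -> homS b s ->
  ext_hom homM homS (a + b) (tens phi m s).
Proof.
move=> hm hs; exists [:: (m, s)] => // p; rewrite inE => /eqP ->.
by exists a, b.
Qed.

End ExtHom.

Section ExtMapTens.
Variables (R S : comNzRingType) (phi : {rmorphism R -> S}) (M N : lmodType R).

Lemma ext_map_tens (f : {linear M -> N}) m s :
  ext_map phi f (tens phi m s) = tens phi (f m) s.
Proof. exact: ext_mapE. Qed.

End ExtMapTens.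

(** * The action of A on the circle through the base point *)

Section FreeBasis.
Variables (F : frobenius_system) (D : knot_diagram).
Let n := ncross D.
Let R := fbase F.
Let A := falg F.

Definition based (x : label D) : bool := base_circle x.1 \in x.2.

Lemma unbase_subproof i (x : estate D i) :
  wf i ((val x).1, (val x).2 :\ base_circle (val x).1).
Proof.
have /andP[sx hx] := valP x.
by rewrite /wf /= hx (subset_trans (subD1set _ _) sx).
Qed.

Definition unbase i (x : estate D i) : estate D i := Sub _ (unbase_subproof x).

Lemma unbase_id i (x : estate D i) : ~~ based (val x) -> unbase x = x.
Proof.
move=> bx; apply: val_inj => /=; rewrite [RHS]surjective_pairing; congr (_, _).
apply/setP=> e; rewrite !inE; case: eqP => // ->.
by apply/esym/negbTE.
Qed.

Lemma based_unbase i (x : estate D i) : ~~ based (val (unbase x)).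
Proof. by rewrite /based !inE eqxx. Qed.

Lemma fXn_coef (b k : bool) : (fX F ^+ b)`_k = (b == k)%:R.
Proof. by have := actc1 F b k; rewrite /actc mul1r. Qed.

Lemma falg_eqP (a b : A) : (forall k : bool, a`_k = b`_k) -> a = b.
Proof.
by move=> h; rewrite [a]falg_eta [b]falg_eta (h false) (h true).
Qed.

Lemma falg_coef_sum (I : Type) (r : seq I) (P : pred I) (a : I -> A) k :
  (\sum_(i <- r | P i) a i : A)`_k = \sum_(i <- r | P i) (a i)`_k.
Proof.
elim/big_rec2: _ => [|i x y _ <-]; last exact: falg_coefD.
by rewrite -(scale0r (0 : A)) falg_coefZ mul0r.
Qed.

Definition delta i (x : estate D i) : kterm F D i := [ffun y => (y == x)%:R].

Lemma alg_kscaleE i (r : R) (f : kterm F D i) y :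
  (r%:A *: f : kterm F D i) y = r * f y.
Proof.
have -> : r%:A *: f = kscale (r%:A) f by [].
have {2}-> : f = kscale 1 f by rewrite kscale1.
rewrite !ffunE mulr_sumr; apply: eq_bigr => x _; rewrite mulrA; congr (_ * _).
rewrite /act_coef; case: ifP; rewrite ?mulr0 // => _.
by rewrite /actc -scalerAl falg_coefZ.
Qed.

Lemma kterm_sum i (f : kterm F D i) : f = \sum_y (f y)%:A *: delta y.
Proof.
apply/ffunP=> x; rewrite sum_ffunE (bigD1 x) //= big1 ?addr0 => [|y yx].
  by rewrite alg_kscaleE ffunE eqxx mulr1.
by rewrite alg_kscaleE ffunE eq_sym (negPf yx) mulr0.
Qed.

Lemma eq_put (g : {set edge n}) (L N : {set {set edge n}}) :
  (N == L) = (N == put g (g \in N) L) && ((g \in L) == (g \in N)).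
Proof.
rewrite -put_eq; have [->|NL] := eqVneq N L; first by rewrite !eqxx.
apply/esym/negbTE/negP => /andP[/eqP h /eqP gLN]; case/eqP: NL.
apply/setP=> e; have [->//|eg] := eqVneq e g.
by move/setP/(_ e): h; rewrite !inE eg.
Qed.

(** [X] acts on the factor of the base circle alone, where it turns the label 1 into X. Labellings
    with 1 on that circle therefore generate over A. *)
Lemma delta_unbase i (x : estate D i) :
  delta x = fX F ^+ based (val x) *: delta (unbase x).
Proof.
apply/ffunP=> y.
have -> : fX F ^+ based (val x) *: delta (unbase x) =
  kscale (fX F ^+ based (val x)) (delta (unbase x)) by [].
rewrite !ffunE (bigD1 (unbase x)) //= big1 ?addr0 => [|z zx]; last first.
  by rewrite ffunE (negPf zx) mulr0.
rewrite ffunE eqxx mulr1 /act_coef /=.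
rewrite !inE eqxx /= /actc expr0 mulr1 setDDl setUid.
have [e1|e1] /= := eqVneq (val y).1 (val x).1; last first.
  rewrite -val_eqE [val y]surjective_pairing [val x in LHS]surjective_pairing.
  by rewrite xpair_eqE (negPf e1).
rewrite put_eq fXn_coef -val_eqE [val y]surjective_pairing.
rewrite [val x in LHS]surjective_pairing xpair_eqE e1 eqxx /based /=.
set g := base_circle _.
by rewrite (eq_put g); case: (_ == put _ _ _).
Qed.

Section Lift.
Variables (i : int) (N : lmodType A) (q : estate D i -> N).

(** Extends [q] linearly over A from the labellings with 1 on the base circle; the label there is
    absorbed into the scalar as a power of [X]. *)
Definition klift (f : kterm F D i) : N :=
  \sum_y (f y *: fX F ^+ based (val y)) *: q (unbase y).

(** The two labellings that differ only at the base circle span a copy of A with coordinates 1 and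
    X, on which [a] acts by multiplication. *)
Lemma act_coef_fX a (x : estate D i) :
  \sum_(y : estate D i) act_coef a (val x) (val y) *: fX F ^+ based (val y) =
  a * fX F ^+ based (val x).
Proof.
apply: falg_eqP => k; rewrite falg_coef_sum.
under eq_bigr do rewrite falg_coefZ.
rewrite (sum_act_l a x (fun z => (fX F ^+ based z)`_k)) /based /=.
under eq_bigr do rewrite in_put fXn_coef.
by rewrite big_bool /actc /=; case: k; rewrite /= ?mulr1 ?mulr0 ?addr0 ?add0r.
Qed.

Lemma klift_is_linear : linear klift.
Proof.
move=> a f f'; rewrite /klift scaler_sumr -[RHS]addrC.
have -> : \sum_i0 a *: ((f i0 *: fX F ^+ based (val i0)) *: q (unbase i0)) =
  \sum_y ((a *: f : kterm F D i) y *: fX F ^+ based (val y)) *: q (unbase y).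
  have -> : a *: f = kscale a f by [].
  under [RHS]eq_bigr do rewrite ffunE scaler_suml scaler_suml.
  rewrite exchange_big; apply: eq_bigr => x _ /=.
  rewrite scalerA -scalerAr -act_coef_fX scaler_sumr scaler_suml.
  apply: eq_bigr => y _; rewrite scalerA [_ * f x]mulrC.
  (* A nonzero [act_coef] forces [x] and [y] to agree off the base circle, so they have the same
     [unbase]. *)
  set g := base_circle (val x).1.
  have [h|h] := boolP (((val y).1 == (val x).1) &&
    ((val y).2 :\ g == (val x).2 :\ g)); last first.
    by rewrite /act_coef (negPf h) mulr0 !scale0r.
  congr (_ *: q _); apply: val_inj => /=.
  by move/andP: h => [/eqP -> /eqP ->].
rewrite addrC -big_split /=; apply: eq_bigr => y _.
by rewrite !ffunE !scalerDl.
Qed.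

HB.instance Definition _ :=
  GRing.isLinear.Build A (kterm F D i) N _ klift klift_is_linear.

Lemma klift_delta x : ~~ based (val x) -> klift (delta x) = q x.
Proof.
move=> bx; rewrite /klift (bigD1 x) //= big1 ?addr0 => [|y yx].
  by rewrite ffunE eqxx (negPf bx) scale1r scale1r unbase_id.
by rewrite ffunE (negPf yx) !scale0r.
Qed.

End Lift.

Lemma kterm_basisE i (f : kterm F D i) :
  f = \sum_(x | ~~ based (val x))
    (\sum_(y | unbase y == x) f y *: fX F ^+ based (val y)) *: delta x.
Proof.
under [RHS]eq_bigr do rewrite scaler_suml.
rewrite (exchange_big_dep xpredT) //= {1}[f]kterm_sum.
apply: eq_bigr => y _; rewrite (big_pred1 (unbase y)) /=.
  by rewrite {1}delta_unbase scalerA mulr_algl.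
move=> x; rewrite /= [unbase y == x]eq_sym.
case: eqP => [->|_]; last by rewrite andbF.
by rewrite based_unbase.
Qed.

Lemma kterm_basis i (f : kterm F D i) :
  exists a : estate D i -> A, f = \sum_(x | ~~ based (val x)) a x *: delta x.
Proof.
by exists (fun x => \sum_(y | unbase y == x) f y *: fX F ^+ based (val y));
  exact: kterm_basisE.
Qed.

End FreeBasis.
Arguments delta F {D i} x.
Arguments based {D} x.

Lemma sum_unbase (D : knot_diagram) i (x : estate D i) (R : comNzRingType)
    (G : label D -> R) : ~~ based (val x) ->
  \sum_(y | unbase y == x) G (val y) =
  \sum_b G ((val x).1, put (base_circle (val x).1) b (val x).2).
Proof.
move=> bx.
have wfx : wf i ((val x).1, (val x).2).
  by rewrite -surjective_pairing; exact: (valP x).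
(* The Frobenius system is only a vehicle for R-valued functions. *)
rewrite -(@sum_put (@FrobeniusSystem R 0 0 (fun _ _ => True)) D i _ _ _ G wfx
  (circle_in _ _)).
apply: eq_bigl => y; have := congr1 val (unbase_id bx).
rewrite -val_eqE /=; case: (val x) => v L; case: (val y) => w N /= [LE].
rewrite xpair_eqE; have [->|] //= := eqVneq w v.
by rewrite -[X in _ == X]LE.
Qed.

(** * The substitution at one edge of the cube *)

Section Translation.
Variables (T : finType) (A : comNzRingType).
Implicit Types (z : A) (L K M N : {set T}).

(* trans z L K is the coefficient of \prod_(c in K) x_c in the product
   \prod_(c in L) (x_c + z); transc z is its factor at one circle. *)
Definition transc z (b k : bool) : A :=
  if b then if k then 1 else z else (~~ k)%:R.

Definition trans z L K : A := \prod_c transc z (c \in L) (c \in K).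

Lemma trans_sub z L K : ~~ (K \subset L) -> trans z L K = 0.
Proof.
case/subsetPn=> c cK cL; rewrite /trans (bigD1 c) //= (negPf cL) cK.
by rewrite /transc mul0r.
Qed.

(** Successive translations add up. The sum over intermediate sets is the expansion of a product
    with one two-term factor per circle. *)
Lemma trans_comp z z' L M :
  \sum_K trans z L K * trans z' K M = trans (z + z') L M.
Proof.
transitivity (\prod_c (transc z (c \in L) true * transc z' true (c \in M) +
                       transc z (c \in L) false * transc z' false (c \in M))).
  rewrite bigA_distr; apply: eq_bigr => K _; rewrite /trans -big_split /=.
  by apply: eq_bigr => c _; case: ifP.
apply: eq_bigr => c _; rewrite /transc.
by case: (c \in L); case: (c \in M) => /=; ring.
Qed.

Lemma trans0 L M : trans 0 L M = (L == M)%:R.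
Proof.
case: eqP => [->|LM]; first by rewrite /trans big1 // => c _; case: (c \in M).
have [c h] : exists c, (c \in L) != (c \in M).
  apply/existsP; apply: contra_notT LM; rewrite negb_exists => /forallP h.
  by apply/setP => c; apply/eqP/negbNE/h.
rewrite /trans (bigD1 c) //=.
by move: h; case: (c \in L); case: (c \in M); rewrite //= mul0r.
Qed.

(** [S] and [U] stand for the circles at the crossing before and after an edge of the cube. Outside
    both, the factors do not depend on [K]; a circle in [U] but not in [S] lies in neither [L] nor
    [K] and has factor 1. *)
Lemma trans_split z (S U L M : {set T}) (K : {set T}) :
  K :\: S = M :\: U -> [disjoint L & U :\: S] ->
  trans z L K = (\prod_(c | c \notin S :|: U) transc z (c \in L) (c \in M))
                * \prod_(c in S) transc z (c \in L) (c \in K).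
Proof.
move=> e LU; rewrite /trans (bigID (mem S)) /= mulrC; congr (_ * _).
rewrite (bigID (mem U)) /= big1 ?mul1r => [|c /andP[cS cU]].
  apply: eq_big => c; first by rewrite !inE negb_or.
  move=> /andP[cS cU]; move/setP/(_ c): e.
  by rewrite !inE (negPf cS) (negPf cU) /= => ->.
have -> : (c \in L) = false.
  by apply: (disjointFl LU); rewrite !inE cS cU.
by move/setP/(_ c): e; rewrite !inE (negPf cS) cU /= => ->.
Qed.

(** The mirror image after the edge: a circle in [S] but not in [U] lies in neither [N] nor [M]. The
    first factor is that of [trans_split], so it cancels in a comparison. *)
Lemma trans_splitr z (S U L M : {set T}) (N : {set T}) :
  N :\: U = L :\: S -> [disjoint M & S :\: U] ->
  trans z N M = (\prod_(c | c \notin S :|: U) transc z (c \in L) (c \in M))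
                * \prod_(c in U) transc z (c \in N) (c \in M).
Proof.
move=> e MS; rewrite /trans (bigID (mem U)) /= mulrC; congr (_ * _).
rewrite (bigID (mem S)) /= big1 ?mul1r => [|c /andP[cU cS]].
  apply: eq_big => c; first by rewrite !inE negb_or andbC.
  move=> /andP[cU cS]; move/setP/(_ c): e.
  by rewrite !inE (negPf cS) (negPf cU) /= => ->.
have -> : (c \in M) = false.
  by apply: (disjointFl MS); rewrite !inE cS cU.
by move/setP/(_ c): e; rewrite !inE (negPf cU) cS /= => ->.
Qed.

End Translation.

(** * Multiplication and comultiplication under the substitution Z = Y - X *)

Section StructureConstants.
Variable D : knot_diagram.
Implicit Types (g d : {set edge (ncross D)}).
Implicit Types (B K L N : {set {set edge (ncross D)}}).
Local Notation A := (falg univ_system).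
Local Notation X := (fX univ_system).
Local Notation phi := ZG_A_univ.

Lemma sum_setD1 (V : zmodType) g B (G : {set {set edge (ncross D)}} -> V) :
  g \notin B -> \sum_(K | K :\: [set g] == B) G K = \sum_b G (put g b B).
Proof.
move=> gB; rewrite (reindex_onto (fun b => put g b B) (fun K => g \in K)).
  apply: eq_bigl => b; rewrite in_put eqxx andbT putD1; apply/eqP/setP => e.
  by rewrite !inE; case: eqP => // ->; rewrite (negPf gB).
move=> K /eqP h; apply/esym/eqP; rewrite -put_eq -h.
by rewrite setDDl setUid.
Qed.

Lemma sum_setD2 (V : zmodType) g1 g2 B (G : {set {set edge (ncross D)}} -> V) :
  g1 != g2 -> [disjoint B & [set g1; g2]] ->
  \sum_(K | K :\: [set g1; g2] == B) G K =
  \sum_b1 \sum_b2 G (put g1 b1 (put g2 b2 B)).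
Proof.
move=> g12 dB; rewrite pair_big.
have g1B : g1 \notin B by rewrite (disjointFl dB) ?set21.
have g2B : g2 \notin B by rewrite (disjointFl dB) ?set22.
rewrite (reindex_onto (fun b => put g1 b.1 (put g2 b.2 B))
                      (fun K => (g1 \in K, g2 \in K))) /=.
  apply: eq_bigl => -[b1 b2] /=; rewrite in_put in_putN 1?eq_sym // in_put eqxx.
  rewrite andbT !put_setD ?set21 ?set22 //; apply/eqP/setP => e.
  by rewrite !inE; case: eqP => [->|_]; case: eqP => [->|_] //=;
    rewrite ?(negPf g1B) ?(negPf g2B).
move=> K /eqP h; apply/setP => e.
have [->|e1] := eqVneq e g1; first by rewrite in_put.
rewrite in_putN //; have [->|e2] := eqVneq e g2; first by rewrite in_put.
by rewrite in_putN // -h !inE (negPf e1) (negPf e2).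
Qed.

Definition local_val (F : frobenius_system) g1 g2 d1 d2 L N : fbase F :=
  match g1 == g2, d1 == d2 with
  | false, true => mulc F (g1 \in L) (g2 \in L) (d1 \in N)
  | true, false => comulc F (g1 \in L) (d1 \in N) (d2 \in N)
  | _, _ => 0
  end.

Lemma fX2_univ : X * X = (fh univ_system)%:A * X + (ft univ_system)%:A.
Proof. by rewrite mulr_algl fX2. Qed.

Lemma phi_h : phi (fh ZG_system) = (fh univ_system)%:A - 2 * X.
Proof. by rewrite rmorphN ZG_A_univX opprB. Qed.

Lemma phi_t : phi (ft ZG_system) = 0.
Proof. exact: rmorph0. Qed.

Lemma phi_mulcE i j k : phi (mulc ZG_system i j k) =
  match i, j, k with
  | false, _, _ => (j == k)%:R
  | _, false, _ => (i == k)%:R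
  | true, true, false => 0
  | true, true, true => (fh univ_system)%:A - 2 * X
  end.
Proof.
rewrite mulcE; case: i; case: j; case: k;
  rewrite ?phi_h ?phi_t ?rmorph_nat//.
Qed.

Lemma phi_comulcE i j k : phi (comulc ZG_system i j k) =
  match i, j, k with
  | false, false, false => 2 * X - (fh univ_system)%:A
  | false, false, true | false, true, false => 1
  | true, true, true => 1
  | _, _, _ => 0
  end.
Proof.
by rewrite /comulc; case: i; case: j; case: k;
  rewrite ?phi_t ?rmorph0 ?rmorph1 // rmorphN phi_h opprB.
Qed.

Lemma comulcAE i j k : (comulc univ_system i j k)%:A =
  match i, j, k with
  | false, false, false => - (fh univ_system)%:A
  | false, false, true | false, true, false => 1
  | true, false, false => (ft univ_system)%:A
  | true, true, true => 1
  | _, _, _ => 0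
  end :> A.
Proof.
by rewrite /comulc; case: i; case: j; case: k;
  rewrite ?scaleNr ?scale0r ?scale1r.
Qed.

Lemma mulcAE i j k : (mulc univ_system i j k)%:A =
  match i, j, k with
  | false, _, _ => (j == k)%:R
  | _, false, _ => (i == k)%:R
  | true, true, false => (ft univ_system)%:A
  | true, true, true => (fh univ_system)%:A
  end :> A.
Proof.
by rewrite mulcE; case: i; case: j; case: k => /=; rewrite ?scale0r ?scale1r.
Qed.

Lemma sum_bool (V : nmodType) (G : bool -> V) : \sum_b G b = G true + G false.
Proof. exact: big_bool. Qed.

Lemma transc0T (z : A) : transc z false true = 0. Proof. by []. Qed.
Lemma transc0F (z : A) : transc z false false = 1. Proof. by []. Qed.

Lemma mulcC F i j k : mulc F i j k = mulc F j i k.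
Proof. by rewrite !mulcE; case: i; case: j; case: k. Qed.

Lemma comulcC F i j k : comulc F i j k = comulc F i k j.
Proof. by case: i; case: j; case: k. Qed.

(** Two circles off the base point merge. The only nontrivial relation is (Y - X)^2 = (h - 2X)(Y -
    X), where h - 2X is the image of -G. *)
Lemma merge_identity l1 l2 m :
  \sum_b phi (mulc ZG_system l1 l2 b) * transc (- X) b m =
  \sum_b1 \sum_b2 transc (- X) l1 b1 * transc (- X) l2 b2 *
    (mulc univ_system b1 b2 m)%:A.
Proof.
have := fX2_univ; rewrite !big_bool !phi_mulcE !mulcAE /transc.
move: (fX _) ((fh _)%:A) ((ft _)%:A) => x h t e.
(* Since X^2 = hX + t, eliminating [t] leaves identities that hold for free variables [x] and
   [h]. *)
have -> : t = x * x - h * x by rewrite e; ring.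
by case: l1; case: l2; case: m => /=; ring.
Qed.

(** Merging with the base circle sets Y = X, hence Z = 0, which matches reduction modulo X on the
    Z[G] side. *)
Lemma merge_based_identity l :
  phi (mulc ZG_system false l false) =
  \sum_b transc (- X) l b * \sum_k (mulc univ_system false b k)%:A * X ^+ k.
Proof.
rewrite !big_bool !phi_mulcE !mulcAE /transc; move: (fX _) => x.
by case: l => /=; ring.
Qed.

(** Delta(1) = Y_1 + Y_2 - h = Z_1 + Z_2 + G, and Delta(Z) = Y_1 Y_2 + t - X (Y_1 + Y_2 - h) = Z_1
    Z_2 because t + hX = X^2. *)
Lemma split_identity l m1 m2 :
  \sum_b1 \sum_b2 phi (comulc ZG_system l b1 b2) *
     (transc (- X) b1 m1 * transc (- X) b2 m2) =
  \sum_b transc (- X) l b * (comulc univ_system b m1 m2)%:A.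
Proof.
have := fX2_univ; rewrite !big_bool !phi_comulcE !comulcAE /transc.
move: (fX _) ((fh _)%:A) ((ft _)%:A) => x h t e.
have -> : t = x * x - h * x by rewrite e; ring.
by case: l; case: m1; case: m2 => /=; ring.
Qed.

(** The base circle, labelled 1, splits: Delta(1) with X in the base factor reads X + Y - h = Z +
    G. *)
Lemma split_based_identity m :
  \sum_b phi (comulc ZG_system false false b) * transc (- X) b m =
  \sum_k (comulc univ_system false k m)%:A * X ^+ k.
Proof.
rewrite !big_bool !phi_comulcE !comulcAE /transc.
move: (fX _) ((fh _)%:A) => x h.
by case: m => /=; ring.
Qed.

End StructureConstants.

(** * Commutation of the substitution with one split or merge *)

Section LocalIdentity.
Variable D : knot_diagram.
Implicit Types (L K M N : {set {set edge (ncross D)}}).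
Local Notation A := (falg univ_system).
Local Notation X := (fX univ_system).
Local Notation phi := ZG_A_univ.

Variables (g d g1 g2 d1 d2 : {set edge (ncross D)}).
Variables (L M : {set {set edge (ncross D)}}).
Let S := [set g1; g2].
Let T := [set d1; d2].
Hypotheses (gd : (g \in S) = (d \in T)) (gdE : g \notin S -> d = g).
Hypotheses (gL : g \notin L) (dM : d \notin M).
Hypotheses (LT : [disjoint L & T :\: S]) (MS : [disjoint M & S :\: T]).

Lemma put_falseE : put d false M = M.
Proof.
apply/setP=> e; rewrite /put !inE; case: eqP => // ->.
by rewrite (negPf dM).
Qed.

(** The contribution of the circles away from the crossing, common to both sides of
    [local_identity]. *)
Let Q := \prod_(c | c \notin S :|: T) transc (- X) (c \in L) (c \in M).

Lemma local_lhs :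
  \sum_(N : {set {set edge (ncross D)}} | d \notin N)
    phi (local_coef ZG_system g1 g2 d1 d2 L N) * trans (- X) N M =
  Q * \sum_(N : {set {set edge (ncross D)}} | N :\: T == L :\: S)
    (if d \in N then 0 else phi (local_val ZG_system g1 g2 d1 d2 L N) *
       \prod_(c in T) transc (- X) (c \in N) (c \in M)).
Proof.
rewrite mulr_sumr big_mkcond [RHS]big_mkcond; apply: eq_bigr => N _.
rewrite /local_coef -/S -/T [L :\: S == _]eq_sym.
case: eqP => [e|_]; last by rewrite rmorph0 mul0r if_same.
rewrite -/(local_val _ _ _ _ _ L N); case: (d \in N); rewrite /= ?mulr0 //.
by rewrite (trans_splitr _ e MS) mulrCA.
Qed.

(** Away from the crossing the base circle [d = g] cannot acquire the label X: [local_coef] would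
    force [d] into [K], while [trans] vanishes unless [K] lies in [L], and [g] is not in [L]. Hence
    the restriction on [k]. *)
Lemma local_rhs :
  \sum_(K : {set {set edge (ncross D)}}) trans (- X) L K *
    \sum_k (local_coef univ_system g1 g2 d1 d2 K (put d k M))%:A * X ^+ k =
  Q * \sum_(K : {set {set edge (ncross D)}} | K :\: S == M :\: T)
    (\prod_(c in S) transc (- X) (c \in L) (c \in K)) *
    \sum_(k | (d \in T) || ~~ k)
      (local_val univ_system g1 g2 d1 d2 K (put d k M))%:A * X ^+ (k : bool).
Proof.
rewrite mulr_sumr [RHS]big_mkcond; apply: eq_bigr => K _.
rewrite /local_coef -/S -/T.
have [e|ne] := eqVneq (K :\: S) (M :\: T); last first.
  rewrite big_bool put_falseE (negPf ne) scale0r mul0r. rewrite Monoid.mulm1.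
  have [dT|dT] := boolP (d \in T); first by
    rewrite put_setD // (negPf ne) scale0r mul0r mulr0.
  case: eqP => [h|_]; last by rewrite scale0r mul0r mulr0.
  rewrite trans_sub ?mul0r //; apply/subsetPn; exists d.
    have /setDP[] // : d \in K :\: S by rewrite h inE dT in_put.
  by rewrite gdE // gd.
rewrite (trans_split _ e LT) -!mulrA; congr (_ * (_ * _)).
rewrite [RHS]big_mkcond; apply: eq_bigr => k _.
have [dT|dT] := boolP (d \in T).
  by rewrite orTb put_setD // e eqxx.
rewrite orFb; case: k; rewrite [~~ _]/=; last by rewrite put_falseE e eqxx.
case: eqP => [h|_]; last by rewrite scale0r mul0r.
have : d \in K :\: S by rewrite h inE dT in_put.
by rewrite e inE (negPf dM) andbF.
Qed.

Lemma local_identity :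
  \sum_(N : {set {set edge (ncross D)}} | d \notin N)
    phi (local_coef ZG_system g1 g2 d1 d2 L N) * trans (- X) N M =
  \sum_(K : {set {set edge (ncross D)}}) trans (- X) L K *
    \sum_k (local_coef univ_system g1 g2 d1 d2 K (put d k M))%:A * X ^+ k.
Proof.
rewrite local_lhs local_rhs; congr (_ * _).
have filt (G : bool -> A) : \sum_(k | (d \in T) || ~~ k) G k =
    if d \in T then \sum_k G k else G false.
  by case: (d \in T); rewrite //= (big_pred1 false) // => -[].
under [RHS]eq_bigr do rewrite filt; rewrite {filt}.
have dS : [disjoint M :\: T & S].
  apply/pred0P => c; have := @disjointFr _ _ _ c MS.
  rewrite /= !inE; case: (c \in M) => [/(_ isT)|_]; last by rewrite !andbF.
  by case: (c == g1); case: (c == g2); case: (c == d1); case: (c == d2).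
have dT : [disjoint L :\: S & T].
  apply/pred0P => c; have := @disjointFr _ _ _ c LT.
  rewrite /= !inE; case: (c \in L) => [/(_ isT)|_]; last by rewrite !andbF.
  by case: (c == g1); case: (c == g2); case: (c == d1); case: (c == d2).
rewrite /local_val.
(* One circle on both sides of the edge, or two on both, gives coefficient 0 in either system; the
   middle cases are a split and a merge. *)
have [g12|g12] := eqVneq g1 g2; have [d12|d12] := eqVneq d1 d2.
- rewrite [LHS]big1 => [|N _]; last by rewrite rmorph0 mul0r if_same.
  rewrite [RHS]big1 // => K _; rewrite [X in _ * X](_ : _ = 0) ?mulr0 //.
  case: ifP => _; last by rewrite scale0r mul0r.
  by apply: big1 => k _; rewrite scale0r mul0r.
- have Sg : S = [set g1] by rewrite /S -g12 setUid.
  have gS := gd; rewrite Sg in gS dS dT *.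
  rewrite sum_setD2 // sum_setD1 ?(disjointFl dS) ?set11 //.
  under [RHS]eq_bigr do rewrite big_set1 in_put.
  have pT b1 b2 B :
      \prod_(c in T) transc (- X) (c \in put d1 b1 (put d2 b2 B)) (c \in M) =
      transc (- X) b1 (d1 \in M) * transc (- X) b2 (d2 \in M).
    by rewrite big_setU1 ?inE // big_set1 in_put in_putN 1?eq_sym // in_put.
  under [LHS]eq_bigr => b1 _ do under eq_bigr => b2 _ do
    rewrite pT in_put [d2 \in put d1 _ _]in_putN 1?eq_sym // in_put.
  have [dd|dd] := boolP (d \in T).
    have : g \in [set g1] by rewrite gS.
    rewrite inE => /eqP gE; move: gL; rewrite gE => /negPf ->.
    rewrite [RHS]sum_bool transc0T transc0F mul0r mul1r add0r.
    (* The base point may lie on either branch of the split; cocommutativity reduces the second case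
       to the first. *)
    case/set2P: dd => dE; rewrite -dE.
      under [LHS]eq_bigr => b1 _ do under eq_bigr => b2 _ do rewrite in_put.
      rewrite sum_bool big1 // add0r.
      under [RHS]eq_bigr => k _ do rewrite in_put in_putN 1?dE 1?eq_sym //.
      rewrite -split_based_identity; apply: eq_bigr => b _.
      by rewrite (negPf dM) transc0F mul1r.
    have d1d : d1 != d by rewrite dE.
    have dd1 : d != d1 by rewrite eq_sym.
    under [LHS]eq_bigr => b1 _ do
      rewrite sum_bool !(in_putN _ _ dd1) !in_put add0r.
    under [RHS]eq_bigr => k _ do rewrite in_put (in_putN _ _ d1d) comulcC.
    rewrite -split_based_identity; apply: eq_bigr => b _.
    by rewrite comulcC (negPf dM) transc0F mulr1.
  have dg : d = g by apply: gdE; rewrite gd.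
  under [RHS]eq_bigr => b _ do rewrite put_falseE expr0 mulr1.
  rewrite -split_identity; apply: eq_bigr => b1 _; apply: eq_bigr => b2 _.
  move: dd; rewrite !inE negb_or => /andP[dd1 dd2].
  by rewrite !in_putN // dg !inE (negPf gL) andbF.
- have Td : T = [set d1] by rewrite /T -d12 setUid.
  have gS := gd; rewrite Td in gS dS dT *.
  rewrite sum_setD1 ?(disjointFl dT) ?set11 // sum_setD2 //.
  under eq_bigr do rewrite big_set1 in_put.
  have pS b1 b2 B :
      \prod_(c in S) transc (- X) (c \in L) (c \in put g1 b1 (put g2 b2 B)) =
      transc (- X) (g1 \in L) b1 * transc (- X) (g2 \in L) b2.
    by rewrite big_setU1 ?inE // big_set1 in_put in_putN 1?eq_sym // in_put.
  under [RHS]eq_bigr => b1 _ do under eq_bigr => b2 _ do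
    rewrite pS in_put in_putN 1?eq_sym // in_put.
  have [dd|dd] := boolP (d \in [set d1]).
    have gS' : g \in S by rewrite gS.
    move: dd; rewrite inE => /eqP dd; rewrite -dd.
    under [RHS]eq_bigr => b1 _ do under eq_bigr => b2 _ do
      under eq_bigr => k _ do rewrite in_put.
    rewrite [LHS]sum_bool !in_put (negPf dM) add0r transc0F mulr1.
    case/set2P: gS' => gE; move: gL; rewrite gE => /negPf ->.
      rewrite [RHS]sum_bool big1 ?add0r => [|b _]; last first.
        by rewrite transc0T !mul0r.
      rewrite merge_based_identity; apply: eq_bigr => b _.
      by rewrite transc0F mul1r.
    under [RHS]eq_bigr => b _ do
      rewrite sum_bool transc0T transc0F mulr0 mul0r add0r mulr1.
    rewrite mulcC merge_based_identity; apply: eq_bigr => b _.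
    by under [in RHS]eq_bigr do rewrite mulcC.
  have dg : d = g by apply: gdE; rewrite gS.
  under [RHS]eq_bigr => b1 _ do under eq_bigr => b2 _ do
    rewrite put_falseE expr0 mulr1.
  rewrite -merge_identity; apply: eq_bigr => b _.
  rewrite in_putN; last by move: dd; rewrite inE.
  by rewrite dg !inE (negPf gL) andbF.
- rewrite [LHS]big1 => [|N _]; last by rewrite rmorph0 mul0r if_same.
  rewrite [RHS]big1 // => K _; rewrite [X in _ * X](_ : _ = 0) ?mulr0 //.
  case: ifP => _; last by rewrite scale0r mul0r.
  by apply: big1 => k _; rewrite scale0r mul0r.
Qed.

End LocalIdentity.

(** * The isomorphism of complexes *)

Section ReducedCoefficients.
Local Notation A := (falg univ_system).
Local Notation phi := ZG_A_univ.
Local Notation AX := {ideal_quot (X_ideal : idealr (falg ZG_system))}.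

(** Multiples of X have constant coefficient 0 because t = 0 over Z[G], so this coefficient descends
    to the quotient. *)
Lemma mod_X_eq a b : mod_X a = mod_X b -> a`_0 = b`_0.
Proof.
move=> /eqP; rewrite -Quotient.idealrBE => /asboolP[c e].
apply/eqP; rewrite -subr_eq0; apply/eqP.
have <- : (a - b : falg ZG_system)`_0 = a`_0 - b`_0 by rewrite coefB.
by rewrite e (falg_coefM c true false) mulr0.
Qed.

Lemma mod_X_surj (x : AX) : exists a, x = mod_X a.
Proof. by exists (repr x); apply: esym; exact: reprK. Qed.

Lemma mod_X_coef a : mod_X a = ZG_mod_X a`_0.
Proof.
apply/eqP; rewrite -Quotient.idealrBE; apply/asboolP.
exists (a`_1 *: 1); rewrite {1}[a]falg_eta /=.
by rewrite addrAC subrr add0r -scalerAl mul1r.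
Qed.

(* A_{Z[G]} / (X) is Z[G], by the coefficient of 1. *)
Definition psi (x : AX) : A := phi (repr x : falg ZG_system)`_0.

Lemma psi_mod a : psi (mod_X a) = phi a`_0.
Proof. by congr (phi _); apply: mod_X_eq; exact: reprK. Qed.

Lemma psi_ZG r : psi (ZG_mod_X r) = phi r.
Proof. by rewrite psi_mod falg_coefZ falg_coef1 mulr1. Qed.

Lemma psi_is_zmod_morphism : zmod_morphism psi.
Proof.
move=> x y; have [a ->] := mod_X_surj x; have [b ->] := mod_X_surj y.
by rewrite -rmorphB !psi_mod -rmorphB coefB.
Qed.

Lemma psi_is_monoid_morphism : monoid_morphism psi.
Proof.
split; first by rewrite -(rmorph1 mod_X) psi_mod falg_coef1 rmorph1.
move=> x y; have [a ->] := mod_X_surj x; have [b ->] := mod_X_surj y.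
rewrite [mod_X a]mod_X_coef [mod_X b]mod_X_coef -rmorphM !psi_ZG.
by rewrite rmorphM.
Qed.

HB.instance Definition _ :=
  GRing.isZmodMorphism.Build _ _ psi psi_is_zmod_morphism.
HB.instance Definition _ :=
  GRing.isMonoidMorphism.Build _ _ psi psi_is_monoid_morphism.

End ReducedCoefficients.

Section Isomorphism.
Variable D : knot_diagram.
Local Notation A := (falg univ_system).
Local Notation X := (fX univ_system).
Local Notation phi := ZG_A_univ.
Local Notation K := (kterm ZG_system D).
Local Notation C := (kterm univ_system D).
Local Notation B i := (restr ZG_mod_X (ext mod_X (K i))).
Local Notation T i := (ext phi (B i)).

Definition red_gen i (x : estate D i) : T i :=
  tens phi (tens mod_X (delta ZG_system x) 1 : B i) 1.

Lemma tens_alg_surj i (m : ext mod_X (K i)) : exists k, m = tens mod_X k 1.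
Proof.
elim/ext_ind: m => w; rewrite ext_pi_sum.
elim: w => [|[k s] w [k' IH]]; first by exists 0; rewrite big_nil tens0l.
have [a ->] := mod_X_surj s; exists (a *: k + k').
by rewrite big_cons IH tensDl tensZl mulr1.
Qed.

(** Over A_{Z[G]} the labellings with 1 on the base circle span, and modulo X their coefficients
    reduce to constants in Z[G]. *)
Lemma red_gen_span i (z : T i) :
  exists a : estate D i -> A, z = \sum_(x | ~~ based (val x)) a x *: red_gen x.
Proof.
elim/ext_ind: z => w; rewrite ext_pi_sum.
elim: w => [|[m s] w [a IH]].
  by exists (fun=> 0); rewrite big_nil big1 // => x _; rewrite scale0r.
have [k mE] := tens_alg_surj m; have [b kE] := kterm_basis k.
exists (fun x => s * phi (b x)`_0 + a x).
under [RHS]eq_bigr do rewrite scalerDl; rewrite big_split -IH big_cons /=.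
congr (_ + _); rewrite -{1}[s]mulr1 -tensZ mE kE tens_sumZ.
have e : \sum_(x | ~~ based (val x))
      mod_X (b x) *: tens mod_X (delta ZG_system x) 1 =
    \sum_(x | ~~ based (val x))
      (b x)`_0 *: (tens mod_X (delta ZG_system x) 1 : B i) :> B i.
  by apply: eq_bigr => x _; rewrite mod_X_coef.
rewrite [X in tens _ X _]e tens_sumZ scaler_sumr.
by apply: eq_bigr => x _; rewrite scalerA.
Qed.

Definition translate i (N : lmodType A) z (e : estate D i -> N)
    (x : estate D i) : N :=
  \sum_(y : estate D i | (val y).1 == (val x).1)
    trans z (val x).2 (val y).2 *: e y.

(** A_{Z[G]} acts on the target through its quotient by X and [psi]: G acts as 2X - h, but X acts as
    0. The substitution is Z_c = Y_c - X. *)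
Definition to_univ0 i : K i -> restr mod_X (restr psi (C i)) :=
  klift (translate (- X) (@delta univ_system D i)
         : estate D i -> restr mod_X (restr psi (C i))).
HB.instance Definition _ i := GRing.Linear.on (@to_univ0 i).

Definition to_univ1 i : B i -> restr phi (C i) :=
  ext_lift (@to_univ0 i : {linear _ -> _}).

(** [ext_lift] gives linearity over A_{Z[G]}/(X), while the outer tensor product is over Z[G]; the
    actions on the target agree because [psi] after [ZG_mod_X] is [phi]. *)
Lemma to_univ1_is_linear i : linear (@to_univ1 i).
Proof.
move=> r x y.
have -> : r *: x + y = ZG_mod_X r *: (x : ext mod_X (K i)) + y by [].
rewrite /to_univ1 linearP; congr (_ + _).
change (psi (ZG_mod_X r) *: (to_univ1 x : C i) = phi r *: (to_univ1 x : C i)).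
by rewrite psi_ZG.
Qed.
HB.instance Definition _ i :=
  GRing.isLinear.Build _ _ _ _ (@to_univ1 i) (@to_univ1_is_linear i).

Definition to_univ i : T i -> C i := ext_lift (@to_univ1 i : {linear _ -> _}).
HB.instance Definition _ i := GRing.Linear.on (@to_univ i).

Definition of_univ i : C i -> T i := klift (translate X (@red_gen i)).
HB.instance Definition _ i := GRing.Linear.on (@of_univ i).

End Isomorphism.

(** * The two substitutions are mutually inverse *)

Section Inverse.
Variable D : knot_diagram.
Local Notation A := (falg univ_system).
Local Notation X := (fX univ_system).
Local Notation phi := ZG_A_univ.
Local Notation K := (kterm ZG_system D).
Local Notation C := (kterm univ_system D).
Local Notation B i := (restr ZG_mod_X (ext mod_X (K i))).
Local Notation T i := (ext phi (B i)).
Local Notation deltaC := (@delta univ_system D _).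

(** Labellings with X on the base circle drop out, since X acts as 0 on the target. *)
Lemma to_univ0E i (k : K i) : (to_univ0 k : C i) =
  \sum_(y | ~~ based (val y)) phi (k y) *: translate (- X) deltaC y.
Proof.
rewrite /to_univ0 /klift [RHS]big_mkcond /=; apply: eq_bigr => y _.
change (psi (mod_X (k y *: fX ZG_system ^+ based (val y))) *:
  (translate (- X) deltaC (unbase y) : C i) = 
  if ~~ based (val y) then phi (k y) *: translate (- X) deltaC y else 0).
rewrite psi_mod falg_coefZ (fXn_coef _ _ false).
case: (boolP (based (val y))) => b /=; first by rewrite mulr0 rmorph0 scale0r.
by rewrite mulr1 unbase_id.
Qed.

Lemma to_univ_tens i (k : K i) :
  to_univ (tens phi (tens mod_X k 1 : B i) 1) = to_univ0 k :> C i.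
Proof.
rewrite /to_univ ext_lift_tens scale1r.
change (ext_lift (@to_univ0 D i : {linear _ -> _}) (tens mod_X k 1) =
  to_univ0 k :> C i).
rewrite ext_lift_tens.
change (psi 1 *: (to_univ0 k : C i) = to_univ0 k).
by rewrite rmorph1 scale1r.
Qed.

Lemma to_univ_red i (x : estate D i) : ~~ based (val x) ->
  to_univ (red_gen x) = translate (- X) deltaC x.
Proof.
move=> bx; rewrite to_univ_tens to_univ0E (bigD1 x) //=.
rewrite big1 => [|y /andP[_ yx]].
  by rewrite addr0 ffunE eqxx rmorph1 scale1r.
by rewrite ffunE (negPf yx) rmorph0 scale0r.
Qed.

Lemma of_univ_delta i (x : estate D i) : ~~ based (val x) ->
  of_univ (deltaC x) = translate X (@red_gen D i) x.
Proof. exact: klift_delta. Qed.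

Lemma sum_state (V : nmodType) i (v : {set 'I_(ncross D)})
    (G : {set {set edge (ncross D)}} -> V) :
  hdeg v = i ->
  \sum_(y : estate D i | (val y).1 == v) G (val y).2 =
  \sum_(L : {set {set edge (ncross D)}} | L \subset circles v) G L.
Proof.
move=> hv; rewrite (reindex_omap (fun y : estate D i => (val y).2)
  (fun L => insub (v, L))) /=.
  apply: eq_big => y.
    apply/eqP/andP => [e|[_ /eqP]].
      have /andP[h1 _] := valP y; rewrite -e h1; split=> //.
      by apply/eqP; rewrite -surjective_pairing; exact: valK.
    by case: insubP => // z _ zE [zy]; rewrite -zy [sval z]zE.
  by [].
move=> L sL; rewrite insubT //=; rewrite ?sL ?hv ?eqxx //.
Qed.

(** Passes from states to arbitrary sets, the range of summation in [trans_comp] and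
    [local_identity]; the added terms vanish because [trans] is supported on subsets of [L]. *)
Lemma sum_state_trans i (v : {set 'I_(ncross D)})
    (L : {set {set edge (ncross D)}}) z (G : {set {set edge (ncross D)}} -> A) :
  hdeg v = i -> L \subset circles v ->
  \sum_(y : estate D i | (val y).1 == v) trans z L (val y).2 * G (val y).2 =
  \sum_K trans z L K * G K.
Proof.
move=> hv sL; rewrite (sum_state (fun K => trans z L K * G K) hv) big_mkcond.
apply: eq_bigr => K _; case: ifP => // sK; rewrite trans_sub ?mul0r //.
by apply/negP => sKL; rewrite (subset_trans sKL sL) in sK.
Qed.

Lemma trans_based z (x y : label D) :
  y.1 = x.1 -> ~~ based x -> based y -> trans z x.2 y.2 = 0 :> A.
Proof.
rewrite /based => -> bx by_; apply: trans_sub; apply/subsetPn.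
by exists (base_circle x.1).
Qed.

(** Translations by z and -z cancel by [trans_comp] and [trans0]. The hypothesis covers only
    labellings with 1 on the base circle, and [trans_based] keeps the sum among them. *)
Lemma translateK i (N : lmodType A) z (e q : estate D i -> N) :
  (forall y, ~~ based (val y) -> q y = translate (- z) e y) ->
  forall x, ~~ based (val x) -> translate z q x = e x.
Proof.
move=> qE x bx; have /andP[sx /eqP hx] := valP x.
transitivity (\sum_(y | (val y).1 == (val x).1) trans z (val x).2 (val y).2 *:
    translate (- z) e y).
  apply: eq_bigr => y /eqP yx; have [by_|by_] := boolP (based (val y)).
    have -> : trans z (val x).2 (val y).2 = 0.
      exact: (trans_based _ yx bx by_).
    by rewrite !scale0r.
  by rewrite qE.
transitivity (\sum_(w : estate D i | (val w).1 == (val x).1)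
    ((val x).2 == (val w).2)%:R *: e w).
  rewrite /translate; under eq_bigr do rewrite scaler_sumr.
  rewrite (exchange_big_dep (fun w : estate D i => (val w).1 == (val x).1)) /=;
    last first.
    by move=> y w /eqP ->.
  apply: eq_bigr => w /eqP wx; under eq_bigr do rewrite scalerA.
  rewrite -scaler_suml; congr (_ *: _).
  have <- : trans (z - z) (val x).2 (val w).2 = ((val x).2 == (val w).2)%:R.
    by rewrite subrr trans0.
  rewrite -trans_comp.
  rewrite -(sum_state_trans _ (fun L => trans (- z) L (val w).2) hx sx).
  by apply: eq_bigl => y; rewrite wx [_ == (val y).1]eq_sym andbb.
rewrite (bigD1 x) //= eqxx scale1r big1 ?addr0 // => w /andP[/eqP e1 wx].
case: eqP => [e2|]; last by rewrite scale0r.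
case/eqP: wx; apply: val_inj.
by rewrite [LHS]surjective_pairing [RHS]surjective_pairing e1 -e2.
Qed.

Lemma to_univ_comb i (J : finType) (P : pred J) (a : J -> A) (z : J -> T i) :
  to_univ (\sum_(x | P x) a x *: z x) = \sum_(x | P x) a x *: to_univ (z x).
Proof.
rewrite (linear_sum (@to_univ D i)); apply: eq_bigr => x _.
exact: (linearZ_LR (@to_univ D i)).
Qed.

Lemma of_univ_comb i (J : finType) (P : pred J) (a : J -> A) (f : J -> C i) :
  of_univ (\sum_(x | P x) a x *: f x) = \sum_(x | P x) a x *: of_univ (f x).
Proof.
rewrite (linear_sum (@of_univ D i)); apply: eq_bigr => x _.
exact: (linearZ_LR (@of_univ D i)).
Qed.

Lemma of_univK i : cancel (@of_univ D i) (@to_univ D i).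
Proof.
move=> f; have [a ->] := kterm_basis f; rewrite of_univ_comb to_univ_comb.
apply: eq_bigr => x bx; rewrite of_univ_delta // to_univ_comb; congr (_ *: _).
apply: (translateK (q := fun y => to_univ (red_gen y))) => // y by_.
exact: to_univ_red.
Qed.

Lemma to_univK i : cancel (@to_univ D i) (@of_univ D i).
Proof.
move=> f; have [a ->] := red_gen_span f; rewrite to_univ_comb of_univ_comb.
apply: eq_bigr => x bx; rewrite to_univ_red // of_univ_comb; congr (_ *: _).
apply: (translateK (q := fun y => of_univ (deltaC y))) => // y by_.
by rewrite opprK of_univ_delta.
Qed.

End Inverse.

(** * From one edge of the cube to the whole differential *)

Section CubeEdges.
Variable D : knot_diagram.
Let n := ncross D.
Implicit Types (v w : {set 'I_n}) (c : 'I_n).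
Implicit Types (L M : {set {set edge n}}).
Local Notation A := (falg univ_system).
Local Notation X := (fX univ_system).
Local Notation phi := ZG_A_univ.

Lemma in_flip v c j : j != c -> (j \in v) = (j \in c |: v).
Proof. by move=> /negPf jc; rewrite !inE jc. Qed.

(** A circle of [v] away from [c] survives as a circle of [w] away from [c]. This yields both
    disjointness hypotheses of [local_identity]. *)
Lemma touched_disjoint v w c L :
  (forall j, j != c -> (j \in v) = (j \in w)) -> L \subset circles v ->
  [disjoint L & touched w c :\: touched v c].
Proof.
move=> vw /subsetP sL; apply/pred0P => d /=; apply/negbTE/negP.
rewrite in_setD => /and3P[/sL /imsetP[e _ ->] dv].
by rewrite -(circle_flip vw dv) (negPf (touched_flip vw dv)).
Qed.

Lemma touched_circles v c : touched v c \subset circles v.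
Proof. by apply/subsetP => d /set2P[] ->; apply: circle_in. Qed.

Lemma local_coef_supp F (g1 g2 d1 d2 d : {set edge n}) L
    (N : {set {set edge n}}) :
  d \in N -> d \notin [set d1; d2] -> (d \notin [set g1; g2] -> d \notin L) ->
  local_coef F g1 g2 d1 d2 L N = 0.
Proof.
move=> dN dT dL; rewrite /local_coef; case: eqP => // /setP/(_ d).
by rewrite in_setD [RHS]in_setD dN dT => /andP[/dL /negPf ->].
Qed.

(** In a nonzero term, a circle of [N] is either at [c], hence a circle of the target, or belongs to
    [L] and survives the change at [c]. *)
Lemma edge_coef_sub F v c L (N : {set {set edge n}}) : L \subset circles v ->
  ~~ (N \subset circles (c |: v)) -> edge_coef F v c L N = 0.
Proof.
move=> /subsetP sL /subsetPn[d dN dw].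
have dt : d \notin touched (c |: v) c.
  by apply: contra dw => h; apply: (subsetP (touched_circles _ c)).
apply: (local_coef_supp F dN dt) => dv.
apply/negP => /sL /imsetP[e _ dE]; case/negP: dw.
by rewrite dE in dv *; rewrite -(circle_flip (@in_flip v c) dv) circle_in.
Qed.

Lemma edge_identity v c L M : c \notin v ->
  L \subset circles v -> base_circle v \notin L ->
  M \subset circles (c |: v) -> base_circle (c |: v) \notin M ->
  \sum_(N : {set {set edge n}} | base_circle (c |: v) \notin N)
    phi (edge_coef ZG_system v c L N) * trans (- X) N M =
  \sum_(N : {set {set edge n}}) trans (- X) L N *
    \sum_k (edge_coef univ_system v c N
      (put (base_circle (c |: v)) k M))%:A * X ^+ k.
Proof.
move=> cv sL bL sM bM.
have vw := @in_flip v c.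
have wv j : j != c -> (j \in c |: v) = (j \in v) by move=> /vw.
have gd : (base_circle v \in touched v c) =
          (base_circle (c |: v) \in touched (c |: v) c).
  apply/idP/idP; apply: contraTT => h.
    exact: (@touched_flip D _ v c wv ord0 h).
  exact: (@touched_flip D v _ c vw ord0 h).
have gdE : base_circle v \notin touched v c ->
    base_circle (c |: v) = base_circle v.
  by move=> h; apply: (circle_flip vw h).
have LT := touched_disjoint vw sL.
have MS := touched_disjoint wv sM.
exact (local_identity gd gdE bL bM LT MS).
Qed.

Lemma diff_identity i v w L M : hdeg v = i -> hdeg w = i + 1 ->
  L \subset circles v -> base_circle v \notin L ->
  M \subset circles w -> base_circle w \notin M ->
  \sum_(y : estate D (i + 1) | ((val y).1 == w) && ~~ based (val y))
    phi (diff_coef ZG_system (v, L) (val y)) * trans (- X) (val y).2 M =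
  \sum_(z : estate D i | (val z).1 == v)
    trans (- X) L (val z).2 *
    \sum_k (diff_coef univ_system (val z)
      (w, put (base_circle w) k M))%:A * X ^+ k.
Proof.
move=> hv hw sL bL sM bM.
transitivity (\sum_(N : {set {set edge n}} | N \subset circles w)
    if base_circle w \notin N
    then phi (diff_coef ZG_system (v, L) (w, N)) * trans (- X) N M else 0).
  rewrite -[RHS](sum_state (fun N => if base_circle w \notin N
    then phi (diff_coef ZG_system (v, L) (w, N)) * trans (- X) N M else 0) hw).
  rewrite [LHS]big_mkcondr; apply: eq_bigr => y /eqP yw.
  by rewrite /based yw [X in diff_coef _ _ X]surjective_pairing yw.
transitivity (\sum_(N : {set {set edge n}}) trans (- X) L N *
    \sum_k (diff_coef univ_system (v, N)
      (w, put (base_circle w) k M))%:A * X ^+ k); last first.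
  rewrite -(sum_state_trans _ (fun N => \sum_k (diff_coef univ_system (v, N)
    (w, put (base_circle w) k M))%:A * X ^+ k) hv sL).
  by apply: eq_bigr => z /eqP; case: (val z) => v' N /= ->.
rewrite /diff_coef.
(* The sign depends on [v] and [c] alone, so it comes out of both sides and one edge can be treated
   at a time. *)
pose sgn c : A := (-1) ^+ #|[set j in v | (j < c)%N]|.
transitivity (\sum_(c | (c \notin v) && (w == c |: v)) sgn c *
   \sum_(N : {set {set edge n}} | N \subset circles w)
    if base_circle w \notin N
    then phi (edge_coef ZG_system v c L N) * trans (- X) N M else 0).
  under [RHS]eq_bigr do rewrite mulr_sumr.
  rewrite [RHS]exchange_big; apply: eq_bigr => N _.
  case: ifP => _; last by rewrite big1 // => c _; rewrite mulr0.
  rewrite rmorph_sum mulr_suml; apply: eq_bigr => c _.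
  by rewrite rmorphM rmorph_sign mulrA.
transitivity (\sum_(c | (c \notin v) && (w == c |: v)) sgn c *
   \sum_(N : {set {set edge n}}) trans (- X) L N *
    \sum_k (edge_coef univ_system v c N (put (base_circle w) k M))%:A * X ^+ k);
  last first.
  under eq_bigr do rewrite mulr_sumr.
  rewrite exchange_big; apply: eq_bigr => N _.
  under eq_bigr do rewrite mulrCA.
  rewrite -mulr_sumr; congr (_ * _).
  under eq_bigr do rewrite mulr_sumr.
  rewrite exchange_big; apply: eq_bigr => k _.
  rewrite scaler_suml mulr_suml; apply: eq_bigr => c _.
  by rewrite -!in_algE rmorphM rmorph_sign mulrA.
apply: eq_bigr => c /andP[cv /eqP wE]; congr (_ * _); subst w.
rewrite -edge_identity // [RHS]big_mkcond [LHS]big_mkcond.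
apply: eq_bigr => N _; case: ifP => // /negbT sN.
by case: ifP => // _; rewrite edge_coef_sub // rmorph0 mul0r.
Qed.

End CubeEdges.

(** * Compatibility with the differentials *)

Section ChainMap.
Variable D : knot_diagram.
Local Notation A := (falg univ_system).
Local Notation X := (fX univ_system).
Local Notation phi := ZG_A_univ.
Local Notation K := (kterm ZG_system D).
Local Notation C := (kterm univ_system D).
Local Notation B i := (restr ZG_mod_X (ext mod_X (K i))).
Local Notation T i := (ext phi (B i)).
Local Notation deltaC := (@delta univ_system D _).

Definition reduced_complex : gcomplex A :=
  cext phi (gshift 1 (@falg_hom univ_system)) (bracket D).

Lemma kdiff_delta F i (x : estate D i) y :
  kdiff (delta F x) y = diff_coef F (val x) (val y).
Proof.
rewrite ffunE (bigD1 x) //= big1 ?addr0 => [|z zx].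
  by rewrite ffunE eqxx mulr1.
by rewrite ffunE (negPf zx) mulr0.
Qed.

Lemma cdiff_red_gen i (x : estate D i) :
  cdiff reduced_complex i (red_gen x) =
  tens phi (tens mod_X (kdiff (delta ZG_system x)) 1 : B (i + 1)) 1.
Proof.
rewrite [LHS]ext_map_tens; congr (tens phi _ 1).
exact: ext_map_tens.
Qed.

Lemma kdiff_univ_delta i (x : estate D i) :
  kdiff (deltaC x) = \sum_(m : estate D (i + 1) | ~~ based (val m))
    (\sum_k (diff_coef univ_system (val x)
      ((val m).1, put (base_circle (val m).1) k (val m).2))%:A * X ^+ k)
    *: deltaC m.
Proof.
rewrite {1}[kdiff _]kterm_basisE; apply: eq_bigr => m bm; congr (_ *: _).
under eq_bigr do rewrite kdiff_delta.
rewrite (sum_unbase (fun z =>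
  diff_coef univ_system (val x) z *: X ^+ based z)) //.
by apply: eq_bigr => k _; rewrite mulr_algl /based in_put.
Qed.

Lemma kdiff_comb i (J : finType) (P : pred J) (a : J -> A) (f : J -> C i) :
  kdiff (\sum_(x | P x) a x *: f x) = \sum_(x | P x) a x *: kdiff (f x).
Proof.
rewrite (linear_sum (@kdiff univ_system D i)); apply: eq_bigr => x _.
exact: (linearZ_LR (@kdiff univ_system D i)).
Qed.

Lemma to_univ_diff_red i (x : estate D i) : ~~ based (val x) ->
  to_univ (cdiff reduced_complex i (red_gen x) : T (i + 1)) =
  kdiff (to_univ (red_gen x)).
Proof.
move=> bx; have /andP[sx /eqP hx] := valP x.
rewrite cdiff_red_gen to_univ_tens to_univ0E to_univ_red // kdiff_comb.
under eq_bigr do rewrite kdiff_delta scaler_sumr.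
under [RHS]eq_bigr do rewrite kdiff_univ_delta scaler_sumr.
rewrite [RHS]exchange_big /=.
rewrite (exchange_big_dep xpredT) //= [RHS]big_mkcond; apply: eq_bigr => m _.
have /andP[sm /eqP hm] := valP m.
under eq_bigl => y do rewrite andbC eq_sym.
under eq_bigr do rewrite scalerA.
rewrite -scaler_suml.
(* The right side is expanded over labellings with 1 on the base circle; on the left the other
   labellings have coefficient 0. *)
case: (boolP (based (val m))) => bm.
  rewrite big1 ?scale0r // => y /andP[/eqP ym by_].
  by rewrite (@trans_based D (- X) (val y) (val m)) ?mulr0 ?ym.
under [RHS]eq_bigr do rewrite scalerA.
rewrite -scaler_suml -(diff_identity hx hm sx bx sm bm); congr (_ *: _).
Qed.

Lemma to_univ_diff i (z : T i) :
  to_univ (cdiff reduced_complex i z : T (i + 1)) = kdiff (to_univ z).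
Proof.
have [a ->] := red_gen_span z.
rewrite to_univ_comb kdiff_comb (linear_sum (cdiff reduced_complex i)).
rewrite (linear_sum (@to_univ D (i + 1))); apply: eq_bigr => x bx.
rewrite -to_univ_diff_red // -(linearZ_LR (@to_univ D (i + 1))).
by congr to_univ; exact: (linearZ_LR (cdiff reduced_complex i)).
Qed.

Lemma of_univ_diff i (f : C i) :
  of_univ (kdiff f) = cdiff reduced_complex i (of_univ f) :> T (i + 1).
Proof. by rewrite -[in LHS](of_univK f) -to_univ_diff to_univK. Qed.

End ChainMap.

(** * Quantum degrees *)

Section Degrees.
Local Notation A := (falg univ_system).
Local Notation X := (fX univ_system).
Local Notation phi := ZG_A_univ.
Local Notation R := {poly {poly int}}.
Local Notation homR := (@fhom univ_system).
Local Notation homA := (@falg_hom univ_system).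

Lemma homR0 n : homR n 0.
Proof. by move=> i j; rewrite !coef0 eqxx. Qed.

Lemma homRD n (p q : R) : homR n p -> homR n q -> homR n (p + q).
Proof.
move=> hp hq i j; rewrite !coefD => pq.
have [p0|] := eqVneq (p`_j`_i) 0; last exact: hp.
by apply: hq; move: pq; rewrite p0 add0r.
Qed.

Lemma homR_sum n (I : Type) (r : seq I) (P : pred I) (p : I -> R) :
  (forall i, P i -> homR n (p i)) -> homR n (\sum_(i <- r | P i) p i).
Proof. by move=> h; elim/big_ind: _ => //; [exact: homR0 | exact: homRD]. Qed.

Lemma sum_neq0 (V : nmodType) (I : finType) (v : I -> V) :
  \sum_i v i != 0 -> exists i, v i != 0.
Proof.
move=> h; apply/existsP; apply: contraNT h; rewrite negb_exists => /forallP h.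
by rewrite big1 // => i _; apply/eqP/negbNE/h.
Qed.

Lemma homRM a b (p q : R) : homR a p -> homR b q -> homR (a + b) (p * q).
Proof.
move=> hp hq i j; rewrite coefM coef_sum => /sum_neq0[[k kj] /=].
rewrite coefM => /sum_neq0[[l li] /=].
rewrite mulf_eq0 negb_or => /andP[/hp -> /hq ->]; lia.
Qed.

Lemma homR1 : homR 0 1.
Proof. by move=> [|i] [|j]; rewrite !(coef1, coef0) //= coef1. Qed.

Lemma homR_h : homR (-2) (fh univ_system).
Proof.
by move=> i [|j]; rewrite coefC /= ?coef0 // coefX; case: i => [|[|i]].
Qed.

Lemma homR_t : homR (-4) (ft univ_system).
Proof.
by move=> i [|[|j]]; rewrite coefX /= ?coef0 // coef1; case: i.
Qed.

Lemma homA0 n : homA n 0.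
Proof. by split; rewrite coef0; exact: homR0. Qed.

Lemma homAD n (a b : A) : homA n a -> homA n b -> homA n (a + b).
Proof. by move=> [a0 a1] [b0 b1]; split; rewrite falg_coefD; exact: homRD. Qed.

Lemma homA_sum n (I : Type) (r : seq I) (P : pred I) (a : I -> A) :
  (forall i, P i -> homA n (a i)) -> homA n (\sum_(i <- r | P i) a i).
Proof. by move=> h; elim/big_ind: _ => //; [exact: homA0 | exact: homAD]. Qed.

Lemma actc_hom n (a : A) (b k : bool) :
  homA n a -> homR (n - 2 * b%:Z + 2 * k%:Z) (actc a b k).
Proof.
move=> [a0 a1]; rewrite actcE; case: b; case: k => /=.
- apply: homRD; first by have -> : n - 2 * 1 + 2 * 1 = n by lia.
  have -> : n - 2 * 1 + 2 * 1 = n + 2 + -2 by lia.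
  by apply: homRM => //; exact: homR_h.
- have -> : n - 2 * 1 + 2 * 0 = n + 2 + -4 by lia.
  by apply: homRM => //; exact: homR_t.
- by have -> : n - 2 * 0 + 2 * 1 = n + 2 by lia.
- by have -> : n - 2 * 0 + 2 * 0 = n by lia.
Qed.

(** Coefficients of a product are entries of a product of [actc] matrices, whose degrees [actc_hom]
    gives. *)
Lemma homAM m n (a b : A) : homA m a -> homA n b -> homA (m + n) (a * b).
Proof.
move=> ha hb.
have e (k : bool) : (a * b)`_k = \sum_j actc b false j * actc a j k.
  by rewrite -actcM /actc expr0 mulr1.
split; [have := e false | have := e true] => -> ; apply: homR_sum => j _.
- have -> : m + n = (n - 2 * false%:Z + 2 * j%:Z) +
    (m - 2 * j%:Z + 2 * false%:Z) by lia.
  by apply: homRM; apply: actc_hom.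
- have -> : m + n + 2 = (n - 2 * false%:Z + 2 * j%:Z) +
    (m - 2 * j%:Z + 2 * true%:Z) by lia.
  by apply: homRM; apply: actc_hom.
Qed.

Lemma homA1 : homA 0 1.
Proof. by split; rewrite falg_coef1; [exact: homR1 | exact: homR0]. Qed.

Lemma homAX : homA (-2) X.
Proof. by split; rewrite falg_coefX; [exact: homR0 | exact: homR1]. Qed.

Lemma homAN n (a : A) : homA n a -> homA n (- a).
Proof.
move=> [a0 a1]; rewrite -scaleN1r; split; rewrite falg_coefZ mulN1r => i j.
  by rewrite !coefN oppr_eq0 => /a0.
by rewrite !coefN oppr_eq0 => /a1.
Qed.

Lemma homA_alg n (r : R) : homR n r -> homA n (r%:A).
Proof.
move=> hr; split; rewrite falg_coefZ falg_coef1; first by rewrite mulr1.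
by rewrite mulr0; exact: homR0.
Qed.

Lemma homAXn n (a : A) k : homA n a -> homA (n * k%:Z) (a ^+ k).
Proof.
move=> ha; elim: k => [|k IH]; first by rewrite mulr0 expr0; exact: homA1.
have -> : n * k.+1%:Z = n + n * k%:Z by lia.
by rewrite exprS; apply: homAM.
Qed.

(** The image 2X - h of G is homogeneous of degree -2, the degree of G. *)
Lemma phi_hom n (p : {poly int}) : @fhom ZG_system n p -> homA n (phi p).
Proof.
move=> hp; rewrite /ZG_A_univ /= /horner_morph horner_coef.
apply: homA_sum => i _; rewrite coef_map /=.
have [->|/hp ->] := eqVneq (p`_i) 0; first by rewrite mul0r; exact: homA0.
have -> : - (2 * i%:Z) = 0 + (-2) * i%:Z by lia.
apply: homAM.
  have ->: (p`_i)%:~R = ((p`_i)%:~R)%:A :> A by rewrite -in_algE rmorph_int.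
  apply: homA_alg => k j; rewrite -[_%:~R]/(intr _).
  have -> : (p`_i)%:~R = ((p`_i)%:~R)%:P :> R by rewrite rmorph_int.
  rewrite coefC; case: j => [|j]; last by rewrite coef0 eqxx.
  have -> : (p`_i)%:~R = ((p`_i)%:~R)%:P :> {poly int} by rewrite rmorph_int.
  by rewrite coefC; case: k => // k; rewrite eqxx.
apply: homAXn; apply: homAD.
  by rewrite mulr_natl mulr2n; apply: homAD; exact: homAX.
by apply: homAN; apply: homA_alg; exact: homR_h.
Qed.

End Degrees.

Section DegreeZero.
Variable D : knot_diagram.
Local Notation A := (falg univ_system).
Local Notation X := (fX univ_system).
Local Notation phi := ZG_A_univ.
Local Notation homA := (@falg_hom univ_system).
Local Notation K := (kterm ZG_system D).
Local Notation C := (kterm univ_system D).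
Local Notation B i := (restr ZG_mod_X (ext mod_X (K i))).
Local Notation T i := (ext phi (B i)).
Local Notation deltaC := (@delta univ_system D _).

(** The degree predicate of a [gcomplex] comes without laws; these closure properties make
    homogeneity checkable term by term. *)
Definition graded (N : lmodType A) (hom : int -> N -> Prop) : Prop :=
  [/\ forall n, hom n 0,
      forall n x y, hom n x -> hom n y -> hom n (x + y) &
      forall m n a x, homA m a -> hom n x -> hom (m + n) (a *: x)].

Lemma graded_comb (N : lmodType A) (hom : int -> N -> Prop) n (J : eqType)
    (r : seq J) (P : pred J) (a : J -> A) (x : J -> N) :
  graded hom ->
  (forall i, i \in r -> P i ->
     exists p q, [/\ p + q = n, homA p (a i) & hom q (x i)]) ->
  hom n (\sum_(i <- r | P i) a i *: x i).
Proof.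
move=> [h0 hD hZ] h; rewrite big_seq_cond.
elim/big_rec: _ => // i y /andP[ir Pi] hy.
have [p [q [pq ha hx]]] := h i ir Pi.
by apply: hD => //; rewrite -pq; apply: hZ.
Qed.

Lemma card_sum (I : finType) (L : {set I}) : #|L|%:Z = \sum_c (c \in L)%:Z.
Proof.
rewrite -sum1_card big_mkcond /= (big_morph Posz PoszD (erefl _)).
by apply: eq_bigr => c _; case: ifP.
Qed.

Lemma trans_hom (I : finType) z (L M : {set I}) : homA (-2) z ->
  homA (-2 * (#|L|%:Z - #|M|%:Z)) (trans z L M).
Proof.
move=> hz; rewrite !card_sum -sumrB mulr_sumr /trans.
elim/big_rec2: _ => [|c m a _ h]; first exact: homA1.
apply: homAM => //; rewrite /transc.
case: (c \in L); case: (c \in M) => /=.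
- exact: homA1.
- exact: hz.
- exact: homA0.
- exact: homA1.
Qed.

(** Removing X from a circle raises [qdeg] by 2, and the factor [z] left in its place has degree
    -2. *)
Lemma translate_hom i (N : lmodType A) (hom : int -> N -> Prop) z
    (e : estate D i -> N) x :
  graded hom -> homA (-2) z ->
  (forall y, hom (qdeg (val y)) (e y)) -> hom (qdeg (val x)) (translate z e x).
Proof.
move=> gN hz he; apply: graded_comb => // y _ /eqP yx.
exists (-2 * (#|(val x).2|%:Z - #|(val y).2|%:Z)), (qdeg (val y)); split=> //.
  move: yx; rewrite /qdeg; case: (val x) => v L; case: (val y) => w M /= ->.
  by lia.
exact: trans_hom.
Qed.

Lemma qdeg_unbase i (x : estate D i) :
  qdeg (val (unbase x)) = qdeg (val x) + 2 * (based (val x))%:Z.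
Proof.
rewrite /qdeg /= /based; case: (val x) => v L /=.
rewrite (cardsD1 (base_circle v) L) PoszD. ring.
Qed.

Lemma khom_delta F i (x : estate D i) :
  @fhom F 0 1 -> (forall n, @fhom F n 0) ->
  @khom F D i (qdeg (val x)) (delta F x).
Proof.
move=> h1 h0 y; rewrite ffunE; case: eqP => [->|_]; last exact: h0.
by rewrite subrr.
Qed.

Lemma khom_graded i : graded (@khom univ_system D i).
Proof.
split=> [n x|n f g hf hg x|m n a f ha hf y].
- by rewrite ffunE; exact: homR0.
- by rewrite ffunE; apply: homRD.
have -> : a *: f = kscale a f by [].
rewrite ffunE; apply: homR_sum => x _; rewrite /act_coef.
case: ifP => [|_]; last by rewrite mul0r; exact: homR0.
set g := base_circle _ => /andP[/eqP e1 /eqP e2].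
have -> : m + n - qdeg (val y) = (m - 2 * (g \in (val x).2)%:Z
    + 2 * (g \in (val y).2)%:Z) + (n - qdeg (val x)).
  rewrite /qdeg e1 (cardsD1 g (val x).2) (cardsD1 g (val y).2) e2 !PoszD; ring.
by apply: homRM; [apply: actc_hom | apply: hf].
Qed.

Local Notation homT i := (@chom _ (reduced_complex D) i).

Lemma homT_graded i : graded (homT i).
Proof.
split=> [n|n x y [w1 -> h1] [w2 -> h2]|m n a x ha [w -> h]].
- by exists [::].
- exists (w1 ++ w2); first by rewrite -ext_addE.
  by move=> p; rewrite mem_cat => /orP[]; [apply: h1 | apply: h2].
exists (wscale a w); first exact: ext_scaleE.
move=> p /mapP[q qw ->]; have [b [c [<- hb hc]]] := h q qw.
exists b, (m + c); split=> //=; first by lia.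
by rewrite /gshift -addrA; apply: homAM.
Qed.

Lemma red_gen_hom i (x : estate D i) : homT i (qdeg (val x)) (red_gen x).
Proof.
(* The shift {-1} in the bracket and the shift {1} of A_univ cancel. *)
have -> : qdeg (val x) = (qdeg (val x) + -1) + 1 by lia.
apply: ext_hom_tens; last by rewrite /gshift subrr; exact: homA1.
apply: ext_hom_tens.
  apply: khom_delta => [[|i0]|n i0]; rewrite ?coef0 ?eqxx // coef1 //.
exists 1; last by rewrite rmorph1.
rewrite subrr; split=> j; rewrite falg_coef1 ?coef0 ?eqxx // coef1.
by case: j.
Qed.

Lemma of_univ_hom i :
  preserves_degree (@khom univ_system D i) (homT i) (@of_univ D i).
Proof.
move=> n f hf; rewrite /of_univ /klift.
apply: graded_comb => [|y _ _]; first exact: homT_graded.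
exists (n - qdeg (val (unbase y))), (qdeg (val (unbase y))); split.
- by rewrite subrK.
- have -> : n - qdeg (val (unbase y)) =
    (n - qdeg (val y)) + (-2) * (based (val y))%:Z by rewrite qdeg_unbase; ring.
  rewrite -mulr_algl; apply: homAM; first exact/homA_alg/hf.
  by apply: homAXn; exact: homAX.
apply: translate_hom; [exact: homT_graded | exact: homAX | exact: red_gen_hom].
Qed.

Lemma to_univ0_hom i n (k : K i) : khom n k ->
  @khom univ_system D i n (to_univ0 k).
Proof.
move=> hk; rewrite to_univ0E; apply: graded_comb => [|y _ _].
  exact: khom_graded.
exists (n - qdeg (val y)), (qdeg (val y)); split; first by rewrite subrK.
  exact/phi_hom/hk.
apply: translate_hom; [exact: khom_graded | exact: homAN homAX|].
by move=> w; apply: khom_delta; [exact: homR1 | exact: homR0].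
Qed.

Lemma to_univ_hom i :
  preserves_degree (homT i) (@khom univ_system D i) (@to_univ D i).
Proof.
move=> n z [w -> h]; rewrite /to_univ ext_liftE /wlift.
apply: graded_comb => [|[m s] mw _]; first exact: khom_graded.
have [a [b [<- [w' /= -> h'] hs]]] := h _ mw.
(* The shift {1} puts [s] in unshifted degree [b - 1]. The surplus 1 is used up inside the bracket,
   where {-1} puts the scalar in unshifted degree [b' + 1]. *)
exists (b - 1), (a + 1); split=> //; first by lia.
rewrite /to_univ1 ext_liftE /wlift.
apply: (@graded_comb _ (@khom univ_system D i)) => [|[k c] kw _].
  exact: khom_graded.
have [a' [b' [<- hk [c' [hc _] /= ->]]]] := h' _ kw.
exists (b' + 1), a'; split; [by lia | | exact: to_univ0_hom].
by rewrite psi_mod; apply: phi_hom; rewrite opprK in hc.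
Qed.

End DegreeZero.

Theorem theorem1p5 (D : knot_diagram) :
  homotopy_equivalent (C_univ D)
    (cext ZG_A_univ (gshift 1 (@falg_hom univ_system)) (bracket D)).
Proof.
exists (fun i => @of_univ D i : {linear _ -> _}).
exists (fun i => @to_univ D i : {linear _ -> _}).
exists (fun i => \0 : {linear _ -> _}), (fun i => \0 : {linear _ -> _}).
split=> [i|i x|i x|i x|i y].
- split.
  + exact: of_univ_hom.
  + exact: to_univ_hom.
  + by move=> n x _; have [h0 _ _] := @khom_graded D i; exact: h0.
  + by move=> n x _; have [h0 _ _] := @homT_graded D i; exact: h0.
- exact: of_univ_diff.
- exact: to_univ_diff.
- by rewrite [X in X - _]of_univK subrr /= linear0 add0r.
- by rewrite [X in X - _]to_univK subrr /= linear0 add0r.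
Qed.
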